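(* Every Banach space $X$ has the local MAP for $\overline{\mathcal F}$ and the local MAP for $\mathcal N$. If a Banach space $X$ fails the approximation property, then $X$ has neither the weak BAP for $\overline{\mathcal F}$ nor the weak BAP for $\mathcal N$.
   Context: All Banach spaces are over the same field, real or complex. $\mathcal F(X;Y)$ denotes the finite rank bounded operators, $\mathcal F(X)=\mathcal F(X;X)$. $\overline{\mathcal F}$ is the ideal of approximable operators (operator norm limits of finite rank operators) with the operator norm; $\mathcal N$ is the ideal of nuclear operators with the nuclear norm. $X$ has the approximation property if there is a net $(S_\alpha)\subset\mathcal F(X)$ with $S_\alpha\to I_X$ uniformly on compact subsets of $X$. For a Banach operator ideal $(\mathcal A,\|\cdot\|_{\mathcal A})$ and $1\le\lambda<\infty$: $X$ has the weak $\lambda$-BAP for $\mathcal A$ if for every Banach space $Y$ and each $T\in\mathcal A(X;Y)$ there is a net $(S_\alpha)$ in $\mathcal F(X)$ such that $S_\alpha\to I_X$ pointwise and $\limsup_\alpha\|TS_\alpha\|_{\mathcal A}\le\lambda\|T\|_{\mathcal A}$; $X$ has the weak BAP for $\mathcal A$ if this holds for some $\lambda$. $X$ has the local $\lambda$-BAP for $\mathcal A$ if for every Banach space $Y$ and each $T\in\mathcal A(X;Y)$ there is a net $(T_\alpha)$ in $\mathcal F(X;Y)$ such that $T_\alpha\to T$ pointwise and $\limsup_\alpha\|T_\alpha\|_{\mathcal A}\le\lambda\|T\|_{\mathcal A}$; the local MAP for $\mathcal A$ is the local $1$-BAP for $\mathcal A$. *)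

(* Defs.v *)
From HB Require Import structures.
From mathcomp Require Import all_boot all_order all_algebra.
From mathcomp Require Import all_classical all_reals all_analysis.
From mathcomp Require Import complex.
Set Implicit Arguments.
Unset Strict Implicit.
Unset Printing Implicit Defensive.
Import Order.TTheory GRing.Theory Num.Theory.
Import numFieldNormedType.Exports.
Local Open Scope classical_set_scope.
Local Open Scope ring_scope.

Inductive scalars := RealScalars | ComplexScalars.

Definition scalar_field (R : realType) (s : scalars) : numFieldType :=
  match s with
  | RealScalars => R
  | ComplexScalars => (R[i])%C
  end.

Definition scalar_re (R : realType) (s : scalars) : scalar_field R s -> R :=
  match s with
  | RealScalars => fun a => a
  | ComplexScalars => fun a => complex.Re a
  end.

Notation banachType R s := (completeNormedModType (scalar_field R s)).

(* In the library the norm of a normed module takes its values in the scalar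
   field; over the complex numbers these are complex numbers with zero
   imaginary part. *)
Definition rnorm (R : realType) (s : scalars)
    (X : normedModType (scalar_field R s)) (x : X) : R :=
  @scalar_re R s `|x|.

(* Possibly +oo: it is finite exactly when the linear map is bounded. *)
Definition opnorm (R : realType) (s : scalars)
    (X Y : normedModType (scalar_field R s)) (T : {linear X -> Y}) : \bar R :=
  ereal_sup [set (rnorm (T x))%:E | x in [set x : X | rnorm x <= 1]].

Definition finite_rank (R : realType) (s : scalars)
    (X Y : normedModType (scalar_field R s)) (T : {linear X -> Y}) : Prop :=
  continuous T /\
  exists (n : nat) (e : 'I_n -> Y),
    range T = range (fun c : 'I_n -> scalar_field R s => \sum_i c i *: e i).

Record directed_set := DirectedSet {
  dir_carrier :> Type;
  dir_le : dir_carrier -> dir_carrier -> Prop;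
  dir_inhabited : inhabited dir_carrier;
  dir_refl : forall i, dir_le i i;
  dir_trans : forall i j k, dir_le i j -> dir_le j k -> dir_le i k;
  dir_upper : forall i j, exists k, dir_le i k /\ dir_le j k
}.

Definition net_filter (I : directed_set) : set_system I :=
  filter_from [set: I] (fun i => [set j | dir_le i j]).

Arguments net_filter I : clear implicits.

Definition net_limsup (R : realType) (I : directed_set) (a : I -> \bar R) :
    \bar R :=
  ereal_inf
    (range (fun i => ereal_sup [set a j | j in [set j | dir_le i j]])).

Definition approximation_property (R : realType) (s : scalars)
    (X : banachType R s) : Prop :=
  exists (I : directed_set) (S : I -> {linear X -> X}),
    (forall i, finite_rank (S i)) /\
    {family compact, fmap (fun i => S i : X -> X) (net_filter I) --> idfun}.

(* A class of operators between Banach spaces together with a norm, as for a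
   Banach operator ideal; the value of the norm outside the class is
   irrelevant. {linear X -> Y} also contains unbounded maps, but membership in
   each of the two classes below forces boundedness. *)
Record normed_class (R : realType) (s : scalars) := NormedClass {
  in_class : forall X Y : banachType R s, {linear X -> Y} -> Prop;
  class_norm : forall X Y : banachType R s, {linear X -> Y} -> \bar R
}.

Definition weak_lambda_BAP (R : realType) (s : scalars)
    (A : normed_class R s) (lambda : R) (X : banachType R s) : Prop :=
  forall (Y : banachType R s) (T : {linear X -> Y}), in_class A T ->
  exists (I : directed_set) (S : I -> {linear X -> X}),
    [/\ forall i, finite_rank (S i),
        forall x : X, fmap (fun i => S i x) (net_filter I) --> x
      & (net_limsup (fun i => class_norm A (T \o S i))
           <= lambda%:E * class_norm A T)%E].

Definition weak_BAP (R : realType) (s : scalars)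
    (A : normed_class R s) (X : banachType R s) : Prop :=
  exists2 lambda : R, 1 <= lambda & weak_lambda_BAP A lambda X.

Definition local_lambda_BAP (R : realType) (s : scalars)
    (A : normed_class R s) (lambda : R) (X : banachType R s) : Prop :=
  forall (Y : banachType R s) (T : {linear X -> Y}), in_class A T ->
  exists (I : directed_set) (U : I -> {linear X -> Y}),
    [/\ forall i, finite_rank (U i),
        forall x : X, fmap (fun i => U i x) (net_filter I) --> T x
      & (net_limsup (fun i => class_norm A (U i))
           <= lambda%:E * class_norm A T)%E].

Definition local_MAP (R : realType) (s : scalars)
    (A : normed_class R s) (X : banachType R s) : Prop :=
  local_lambda_BAP A 1 X.

Definition approximable (R : realType) (s : scalars)
    (X Y : banachType R s) (T : {linear X -> Y}) : Prop :=
  exists F : nat -> {linear X -> Y},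
    (forall n, finite_rank (F n)) /\
    (fun n => opnorm (T \- F n)) @ \oo --> 0%E.

Definition approximable_ideal (R : realType) (s : scalars) :
    normed_class R s :=
  {| in_class X Y T := approximable T;
     class_norm X Y T := opnorm T |}.

Definition nuclear_representation (R : realType) (s : scalars)
    (X Y : banachType R s) (T : {linear X -> Y})
    (f : nat -> {linear X -> (scalar_field R s)^o}) (y : nat -> Y) : Prop :=
  (forall n, continuous (f n)) /\
  (forall x : X,
     series (fun n => (f n x : scalar_field R s) *: y n) @ \oo --> T x).

Definition nuclear_sum (R : realType) (s : scalars) (X Y : banachType R s)
    (f : nat -> {linear X -> (scalar_field R s)^o}) (y : nat -> Y) : \bar R :=
  (\sum_(0 <= n <oo) (opnorm (f n) * (rnorm (y n))%:E))%E.

Definition nuclear (R : realType) (s : scalars) (X Y : banachType R s)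
    (T : {linear X -> Y}) : Prop :=
  exists f y, nuclear_representation T f y /\ (nuclear_sum f y < +oo)%E.

Definition nuclear_norm (R : realType) (s : scalars) (X Y : banachType R s)
    (T : {linear X -> Y}) : \bar R :=
  ereal_inf [set r | exists f y,
    nuclear_representation T f y /\ r = nuclear_sum f y].

Definition nuclear_ideal (R : realType) (s : scalars) : normed_class R s :=
  {| in_class X Y T := nuclear T;
     class_norm X Y T := nuclear_norm T |}.

(* Main.v *)
Require Import Defs.
From HB Require Import structures.
From mathcomp Require Import all_boot all_order all_algebra.
From mathcomp Require Import all_classical all_reals all_analysis.
From mathcomp Require Import complex lra.

(** The local statements come from truncation. If finite rank operators [F_n]
    tend to [T] in operator norm, then they tend to [T] pointwise and their
    norms tend to that of [T]. If [T] is nuclear, take a representation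
    [T = sum_n f_n (.) y_n] whose sum of norms is within [e] of the nuclear norm:
    a long enough partial sum is within [e] of [T] in operator norm and its
    nuclear norm is at most the sum of norms of the representation
    ([local_MAP_approximable], [local_MAP_nuclear]).

    The failure statement is a trace duality argument. Suppose that [X] fails
    the approximation property. By Grothendieck's description of compact sets
    the failure is already visible along a sequence [x_n] tending to [0]
    ([compact_null_sequence]): no finite rank [S] makes [sup_n |x_n - S x_n|]
    small. The Hahn-Banach theorem on bounded sequences in [X]
    ([hahn_banach], [complexify], [separating_functional]) then gives functionals
    [a_n] with [sum_n |a_n|] finite such that [S |-> sum_n a_n (S x_n)] vanishes
    on finite rank operators but not at the identity
    ([approximation_property_failure]).

    Such a functional contradicts weak bounded approximation as soon as it
    factors through an operator [T] of the ideal, that is, as soon as it has the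
    form [S |-> <T S>] where the pairing [<U> = sum_n (U x_n)_n] has tails that
    are uniformly small on norm-bounded sets of operators [U] of the ideal. For
    then the pairing is continuous along a net [T S_i] that is bounded in the
    ideal and tends to [T] pointwise, so that [0 = <T S_i>] tends to
    [<T> <> 0] ([not_weak_lambda_BAP]). In both cases [T] is diagonal,
    [z |-> (a_n(z) e)_n] for a fixed nonzero vector [e] of [X]:
    - into [l_1(X)] for the nuclear operators, the tail being at most
      [sup_(n >= M) |x_n|] times the nuclear norm of [U]
      ([not_weak_BAP_nuclear]);
    - into [l_oo(X)] for the approximable operators, after weight has been moved
      from the [x_n] to the [a_n] ([rescale]) so that the functionals tend to
      zero and the vectors are summable; the tail is then at most
      [sum_(n >= M) |x_n|] times the operator norm of [U]
      ([not_weak_BAP_approximable]).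

    Coefficients in [X] rather than in the scalar field make the completeness
    of the two sequence spaces a consequence of that of [X]. *)

Set Implicit Arguments.
Unset Strict Implicit.
Unset Printing Implicit Defensive.
Import Order.TTheory GRing.Theory Num.Theory.
Import numFieldNormedType.Exports.
Local Open Scope classical_set_scope.
Local Open Scope ring_scope.

(** * Real and complex scalars *)

Section Scalars.
Context {R : realType} {s : scalars}.
Local Notation K := (scalar_field R s).

Definition of_real (r : R) : K :=
  match s return scalar_field R s with
  | RealScalars => r
  | ComplexScalars => (r%:C)%C
  end.

Lemma of_realK (r : R) : scalar_re (of_real r) = r.
Proof. by rewrite /of_real; case: s. Qed.

Lemma of_real_ge0K (a : K) : 0 <= a -> of_real (scalar_re a) = a.
Proof.
rewrite /of_real /scalar_re; move: a; case: s => //= a a0.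
by apply: RRe_real; exact: ger0_real.
Qed.

Lemma scalar_reD (a b : K) : scalar_re (a + b) = scalar_re a + scalar_re b.
Proof. by move: a b; rewrite /scalar_re; case: s => //= -[? ?] [? ?]. Qed.

Lemma scalar_re_le (a b : K) : a <= b -> scalar_re a <= scalar_re b.
Proof.
by move: a b; rewrite /scalar_re; case: s => //= a b; rewrite lecE => /andP[].
Qed.

Lemma of_real_le (a b : R) : (of_real a <= of_real b) = (a <= b).
Proof. by rewrite /of_real; case: s => //=; rewrite lecR. Qed.

Lemma of_real_lt (a b : R) : (of_real a < of_real b) = (a < b).
Proof. by rewrite /of_real; case: s => //=; rewrite ltcR. Qed.

Lemma of_realD (a b : R) : of_real (a + b) = of_real a + of_real b.
Proof. by rewrite /of_real; case: s => //=; rewrite rmorphD. Qed.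

Lemma of_realM (a b : R) : of_real (a * b) = of_real a * of_real b.
Proof. by rewrite /of_real; case: s => //=; rewrite rmorphM. Qed.

Lemma of_real0 : of_real 0 = 0. Proof. by rewrite /of_real; case: s. Qed.

Lemma of_real1 : of_real 1 = 1. Proof. by rewrite /of_real; case: s. Qed.

Lemma of_realN (a : R) : of_real (- a) = - of_real a.
Proof. by rewrite /of_real; case: s => //=; rewrite rmorphN. Qed.

Lemma norm_of_real (r : R) : `|of_real r| = of_real `|r|.
Proof.
have [r0|r0] := leP 0 r; first by rewrite !ger0_norm// -of_real0 of_real_le.
by rewrite !ltr0_norm ?of_realN// -of_real0 of_real_lt.
Qed.

(** The functional [u] is the real part of the linear functional
    [z |-> u z - i u (i z)], the only possible one. *)
Lemma complexify (V : lmodType K) (u : V -> R) :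
  (forall x y, u (x + y) = u x + u y) ->
  (forall r x, u (of_real r *: x) = r * u x) ->
  exists f : V -> K, linear f /\ forall x, scalar_re (f x) = u x.
Proof.
move: V u; rewrite /scalar_re /of_real; case: s => /= V u uD uZ.
  by exists u; split => // a x y; rewrite uD uZ.
pose i : R[i] := Complex 0 1.
have rz r (x : V) : u ((r%:C)%C *: x) = r * u x by exact: uZ.
have uZ' (z : R[i]) x : u (z *: x) = complex.Re z * u x + complex.Im z * u (i *: x).
  rewrite -rz -rz -uD scalerA -scalerDl; congr (u (_ *: _)).
  by rewrite [LHS]complexE mulrC.
have ii : i * i = -1.
  by apply/eqP; rewrite eq_complex /= !(mul0r, mulr0, mulr1, addr0, sub0r) oppr0 !eqxx.
have uN x : u (- x) = - u x.
  by have := rz (-1) x; rewrite mulN1r rmorphN rmorph1 scaleN1r.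
exists (fun x => Complex (u x) (- u (i *: x))); split => // z x y.
rewrite scalerDr scalerA [i * z]mulrC -scalerA !uD !(uZ' z) scalerA ii scaleN1r uN.
case: z => a b; apply/eqP; rewrite eq_complex /= mulrN mulrN opprK eqxx /=.
by apply/eqP; rewrite !opprD mulrN opprK; congr (_ + _); rewrite addrC.
Qed.
End Scalars.


(** * Real-valued norms and bounded operators *)

Section RealNorm.
Context {R : realType} {s : scalars}.
Local Notation K := (scalar_field R s).
Implicit Types (X Y : normedModType K).

Lemma normE_rnorm X (x : X) : `|x| = of_real (rnorm x).
Proof. by rewrite /rnorm of_real_ge0K. Qed.

Lemma rnorm_ge0 X (x : X) : 0 <= rnorm x.
Proof. by rewrite -(of_real_le (s := s)) of_real0 -normE_rnorm. Qed.

Lemma rnorm0 X : rnorm (0 : X) = 0.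
Proof. by rewrite /rnorm normr0 -(of_real0 (s := s)) of_realK. Qed.

Lemma rnorm0_eq0 X (x : X) : rnorm x = 0 -> x = 0.
Proof. by move=> x0; apply/normr0_eq0; rewrite normE_rnorm x0 of_real0. Qed.

Lemma rnormN X (x : X) : rnorm (- x) = rnorm x.
Proof. by rewrite /rnorm normrN. Qed.

Lemma rnormBC X (x y : X) : rnorm (x - y) = rnorm (y - x).
Proof. by rewrite -rnormN opprB. Qed.

Lemma rnormD X (x y : X) : rnorm (x + y) <= rnorm x + rnorm y.
Proof.
by rewrite -(of_real_le (s := s)) of_realD -!normE_rnorm ler_normD.
Qed.

Lemma rnormB X (x y : X) : rnorm (x - y) <= rnorm x + rnorm y.
Proof. by rewrite (le_trans (rnormD _ _))// rnormN. Qed.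

Lemma rnorm_distD X (z x y : X) : rnorm (x - y) <= rnorm (x - z) + rnorm (z - y).
Proof. by rewrite (le_trans _ (rnormD _ _))// addrA subrK. Qed.

Lemma rnorm_sum X (I : Type) (r : seq I) (F : I -> X) :
  rnorm (\sum_(i <- r) F i) <= \sum_(i <- r) rnorm (F i).
Proof.
elim/big_ind2 : _ => [|x a y b xa yb|//]; first by rewrite rnorm0.
by rewrite (le_trans (rnormD _ _))// lerD.
Qed.

Lemma rnormZ X (a : K) (x : X) : rnorm (a *: x) = rnorm (a : K^o) * rnorm x.
Proof.
apply/le_anti; rewrite -!(of_real_le (s := s)) of_realM -!normE_rnorm.
by rewrite normrZ lexx.
Qed.

Lemma rnormM (a b : K^o) : rnorm (a * b : K^o) = rnorm a * rnorm b.
Proof. exact: (@rnormZ K^o). Qed.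

Lemma rnorm_of_real (r : R) : rnorm (of_real r : (scalar_field R s)^o) = `|r|.
Proof. by rewrite /rnorm norm_of_real of_realK. Qed.

Lemma rnormZr X (r : R) (x : X) : rnorm (of_real r *: x) = `|r| * rnorm x.
Proof. by rewrite rnormZ rnorm_of_real. Qed.

Lemma scalar_re_le_rnorm (a : K^o) : scalar_re a <= rnorm a.
Proof.
rewrite /rnorm; move: a; rewrite /scalar_re; case: s => a; first exact: ler_norm.
have /= := @scalar_re_le R ComplexScalars _ _ (normc_ge_Re a).
exact/le_trans/ler_norm.
Qed.

(** The phase of a scalar: it turns a real-part estimate into an estimate of
    the modulus. *)
Lemma phase (a : K) :
  exists c : K, rnorm (c : K^o) = 1 /\ c * a = of_real (rnorm (a : K^o)).
Proof.
have [->|a0] := eqVneq a 0.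
  by exists 1; rewrite /rnorm normr1 normr0 mulr0 -of_real1 -of_real0 !of_realK.
exists (`|a| / a); rewrite divfK// -normE_rnorm; split => //.
by rewrite /rnorm normrM normr_id normfV divff ?normr_eq0// -of_real1 of_realK.
Qed.

Lemma cvg_rnormP X (F : set_system X) {FF : Filter F} (x : X) :
  F --> x <-> forall e : R, 0 < e -> \forall y \near F, rnorm (x - y) < e.
Proof.
split => [/cvgrPdist_lt h e e0|h].
  have /h : 0 < of_real e :> K by rewrite -of_real0 of_real_lt.
  by apply: filterS => y; rewrite normE_rnorm of_real_lt.
apply/cvgrPdist_lt => e e0.
have eE : e = of_real (scalar_re e) by rewrite of_real_ge0K// ltW.
move: e0; rewrite eE -{1}of_real0 of_real_lt => /h.
by apply: filterS => y; rewrite normE_rnorm of_real_lt.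
Qed.

Lemma linear_continuousP X Y (T : {linear X -> Y}) :
  continuous T <-> exists C : R, 0 <= C /\ forall x, rnorm (T x) <= C * rnorm x.
Proof.
split => [cT|[C [C0 hC]]]; last first.
  move=> x; apply/cvg_rnormP => e e0.
  have C1 : 0 < C + 1 by rewrite ltr_wpDl.
  have := ((cvg_rnormP (X := X) (FF := nbhs_filter (x : X)) x).1 cvg_id) (e / (C + 1)).
  rewrite divr_gt0// => /(_ isT); apply: filterS => y.
  rewrite ltr_pdivlMr// => xy; rewrite /= -linearB (le_lt_trans _ xy)//.
  by rewrite (le_trans (hC _))// mulrC ler_wpM2l ?rnorm_ge0 // lerDl.
have /nbhs_ballP[e /= e0 he] :=
  (cvg_rnormP (FF := fmap_filter _ (nbhs_filter (0 : X))) (T 0)).1 (cT 0) 1 ltr01.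
have eE : e = of_real (scalar_re e) by rewrite of_real_ge0K// ltW.
move: (scalar_re e) eE => r eE; rewrite eE -of_real0 of_real_lt in e0.
exists (2 / r); split; first by rewrite divr_ge0// ltW.
move=> x; have [->|x0] := eqVneq x 0.
  by rewrite linear0 !rnorm0 mulr0.
have nx : 0 < rnorm x.
  by rewrite lt_neqAle rnorm_ge0 andbT eq_sym; apply: contraNN x0 => /eqP/rnorm0_eq0/eqP.
pose t := r / 2 / rnorm x.
have t0 : 0 < t by rewrite !divr_gt0.
have := he (of_real t *: x).
rewrite -ball_normE /= linear0 !sub0r normrN normE_rnorm rnormZr eE of_real_lt gtr0_norm//.
rewrite rnormN linearZ_LR rnormZr gtr0_norm//.
have -> : t * rnorm x = r / 2 by rewrite /t divfK// gt_eqF.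
rewrite gtr_pMr// invf_lt1// ltr1n => /(_ isT) h.
have -> : 2 / r * rnorm x = t^-1 by rewrite /t !invfM !invrK [2 / r]mulrC.
by rewrite -[X in _ <= X]mul1r ler_pdivlMr// mulrC ltW.
Qed.

Lemma rnorm_le_opnorm X Y (T : {linear X -> Y}) (C : R) :
  (opnorm T <= C%:E)%E -> forall x, rnorm (T x) <= C * rnorm x.
Proof.
move=> TC x; have [->|x0] := eqVneq x 0.
  by rewrite linear0 !rnorm0 mulr0.
have nx : 0 < rnorm x.
  by rewrite lt_neqAle rnorm_ge0 andbT eq_sym; apply: contraNN x0 => /eqP/rnorm0_eq0/eqP.
rewrite -ler_pdivrMr//.
have t0 : 0 <= (rnorm x)^-1 by rewrite invr_ge0 ltW.
have := @ereal_sup_ubound _ [set (rnorm (T x))%:E | x in [set x : X | rnorm x <= 1]]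
   (rnorm (T (of_real (rnorm x)^-1 *: x)))%:E.
rewrite linearZ_LR rnormZr ger0_norm// => h.
rewrite mulrC -lee_fin (le_trans _ TC)// h//=.
exists (of_real (rnorm x)^-1 *: x); last by rewrite linearZ_LR rnormZr ger0_norm.
by rewrite rnormZr ger0_norm// mulVf// gt_eqF.
Qed.

Lemma opnorm_le X Y (T : {linear X -> Y}) (C : R) : 0 <= C ->
  (forall x, rnorm (T x) <= C * rnorm x) -> (opnorm T <= C%:E)%E.
Proof.
move=> C0 h; apply: ge_ereal_sup => _ [x /= x1 <-]; rewrite lee_fin.
by rewrite (le_trans (h x))// ler_piMr.
Qed.

Lemma opnorm_ge0 X Y (T : {linear X -> Y}) : (0 <= opnorm T)%E.
Proof.
apply: ereal_sup_ubound; exists 0; last by rewrite linear0 rnorm0.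
by rewrite /= rnorm0.
Qed.

Lemma opnorm_fin X Y (T : {linear X -> Y}) : continuous T ->
  opnorm T = (fine (opnorm T))%:E.
Proof.
move=> /linear_continuousP[C [C0 /(opnorm_le C0) TC]]; rewrite fineK//.
by rewrite ge0_fin_numE ?opnorm_ge0// (le_lt_trans TC) ?ltry.
Qed.

Lemma fine_opnorm_ge0 X Y (T : {linear X -> Y}) : 0 <= fine (opnorm T).
Proof. exact/fine_ge0/opnorm_ge0. Qed.

Lemma rnorm_le_fine_opnorm X Y (T : {linear X -> Y}) : continuous T ->
  forall x, rnorm (T x) <= fine (opnorm T) * rnorm x.
Proof. by move=> cT; apply: rnorm_le_opnorm; rewrite -opnorm_fin. Qed.

End RealNorm.


(** * The Hahn-Banach theorem *)

Section HahnBanach.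
Context {R : realType} {s : scalars} {V : lmodType (scalar_field R s)}.
Implicit Types (p q u : V -> R) (x y z : V) (r t : R).

(** Applied to [r] and to its inverse, the inequality gives positive
    homogeneity; in this form it passes to infima. *)
Definition sublinear p :=
  (forall x y, p (x + y) <= p x + p y) /\
  (forall r x, 0 < r -> p (of_real r *: x) <= r * p x).

Lemma sublinear0 p : sublinear p -> p 0 = 0.
Proof.
move=> [_ pZ]; have := pZ 2 0 (ltr0n _ 2); have := pZ 2^-1 0.
rewrite !scaler0 invr_gt0 ltr0n => /(_ isT); lra.
Qed.

Lemma sublinearZ p r x : sublinear p -> 0 <= r ->
  p (of_real r *: x) = r * p x.
Proof.
move=> sp; rewrite le_eqVlt => /predU1P[<-|r0].
  by rewrite of_real0 scale0r mul0r sublinear0.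
apply/le_anti; rewrite sp.2//=.
have := sp.2 r^-1 (of_real r *: x); rewrite scalerA -of_realM mulVf ?gt_eqF//.
by rewrite of_real1 scale1r invr_gt0 => /(_ r0); rewrite ler_pdivlMl.
Qed.

Lemma sublinear_geN p x : sublinear p -> - p (- x) <= p x.
Proof. by move=> sp; have := sp.1 x (- x); rewrite subrr sublinear0//; lra. Qed.

(** The common source of sublinear functionals below: infima of chains, pushes in
    a direction, and the distance to a subspace. *)
Lemma inf_sublinear (G : set (V -> R)) (l : V -> R) :
  G !=set0 ->
  (forall g x, G g -> l x <= g x) ->
  (forall g h x y, G g -> G h -> exists2 k, G k & k (x + y) <= g x + h y) ->
  (forall g r x, G g -> 0 < r -> exists2 k, G k & k (of_real r *: x) <= r * g x) ->
  exists q, [/\ sublinear q, (forall g x, G g -> q x <= g x) &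
    forall c x, (forall g, G g -> c <= g x) -> c <= q x].
Proof.
move=> [g0 Gg0] Gl GD GZ.
pose A x := [set g x | g in G].
have A0 x : A x !=set0 by exists (g0 x), g0.
have lbA x : has_lbound (A x) by exists (l x) => _ [g Gg <-]; exact: Gl.
pose q x := inf (A x).
have qG g x : G g -> q x <= g x by move=> Gg; apply: ge_inf => //; exists g.
have qinf c x : (forall g, G g -> c <= g x) -> c <= q x.
  by move=> h; apply: lb_le_inf => // _ [g Gg <-]; exact: h.
exists q; split => //; split => [x y|r x r0].
  rewrite -lerBlDr; apply: (qinf) => g Gg.
  rewrite lerBlDr [g x + _]addrC -lerBlDr; apply: (qinf) => h Gh.
  have [k Gk kgh] := GD g h x y Gg Gh.
  by rewrite lerBlDr (le_trans (qG _ _ Gk))// [h y + _]addrC.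
rewrite mulrC -ler_pdivrMr//; apply: (qinf) => g Gg.
have [k Gk kg] := GZ g r x Gg r0.
by rewrite ler_pdivrMr// (le_trans (qG _ _ Gk))// mulrC.
Qed.

(** Zorn's lemma applies because the members of a chain below [p] are bounded
    below by [x |-> - p (- x)]. *)
Lemma minimal_sublinear p : sublinear p ->
  exists q, [/\ sublinear q, (forall x, q x <= p x) &
    forall q', sublinear q' -> (forall x, q' x <= q x) -> q' = q].
Proof.
move=> sp; pose T := {q : V -> R | sublinear q /\ forall x, q x <= p x}.
pose le (q q' : T) := `[< forall x, sval q' x <= sval q x >].
have [||||[q [sq qp]] qmin] := @Zorn T le.
- by move=> q; apply/asboolP.
- move=> q1 q2 q3 /asboolP h1 /asboolP h2; apply/asboolP => x.
  exact: le_trans (h2 x) (h1 x).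
- move=> [q1 h1] [q2 h2] /asboolP /= h /asboolP /= h'; apply: eq_exist => /=.
  by apply/funext => x; apply/le_anti; rewrite h h'.
- move=> A tA; have [A0|/set0P/negP] := pselect (A !=set0); last first.
    rewrite negbK => /eqP ->; have pp : sublinear p /\ forall x, p x <= p x by [].
    by exists (exist _ p pp).
  have [||||q [sq qA _]] := @inf_sublinear [set sval q | q in A] (fun x => - p (- x)).
  + by case: A0 => q Aq; exists (sval q), q.
  + move=> _ x [q Aq <-]; have [sq qp] := svalP q.
    by rewrite (le_trans _ (sublinear_geN x sq))// lerN2.
  + move=> _ _ x y [q1 A1 <-] [q2 A2 <-].
    have [s1 _] := svalP q1; have [s2 _] := svalP q2.
    have [/asboolP le12|/asboolP le21] := tA _ _ A1 A2.
      exists (sval q2); first by exists q2.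
      by rewrite (le_trans (s2.1 _ _))// lerD2r.
    exists (sval q1); first by exists q1.
    by rewrite (le_trans (s1.1 _ _))// lerD2l.
  + move=> _ r x [q Aq <-] r0; exists (sval q); first by exists q.
    by have [[_ sq] _] := svalP q; exact: sq.
  + have [q0 Aq0] := A0.
    have qp : sublinear q /\ forall x, q x <= p x.
      split=> // x; have [_ /(_ x)] := svalP q0; apply: le_trans.
      by apply: qA; exists q0.
    exists (exist _ q qp) => q1 Aq1; apply/asboolP => x /=.
    by apply: qA; exists q1.
exists q; split => // q' sq' q'q.
have q'p : sublinear q' /\ forall x, q' x <= p x.
  by split => // x; exact: le_trans (q'q x) (qp x).
have := qmin (exist _ q' q'p).
by move=> /(_ (asboolT q'q)) /(congr1 sval).
Qed.

(** Pushing [q] in the direction [y] by the infimum over [t] of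
    [q (x + t y) - t q y] yields a smaller sublinear functional along which
    [q] becomes superadditive. *)
Lemma sublinear_push q y : sublinear q ->
  exists q', [/\ sublinear q', (forall x, q' x <= q x) &
    forall x, q' x <= q (x + y) - q y].
Proof.
move=> sq.
pose g t x := q (x + of_real t *: y) - t * q y.
have [||||q' [sq' q'g _]] :=
    @inf_sublinear [set g t | t in [set t | 0 <= t]] (fun x => - q (- x)).
- by exists (g 0), 0; rewrite /= ?lexx.
- move=> _ x [t /= t0 <-]; rewrite /g -(sublinearZ _ sq)//.
  have := sq.1 (x + of_real t *: y) (- x); rewrite addrAC subrr add0r; lra.
- move=> _ _ x x' [t /= t0 <-] [t' /= t'0 <-]; exists (g (t + t')).
    by exists (t + t') => //=; rewrite addr_ge0.
  rewrite /g of_realD scalerDl addrACA mulrDl.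
  have := sq.1 (x + of_real t *: y) (x' + of_real t' *: y); lra.
- move=> _ r x [t /= t0 <-] r0; exists (g (r * t)).
    by exists (r * t) => //=; rewrite mulr_ge0// ltW.
  by rewrite /g of_realM -scalerA -scalerDr (sublinearZ _ sq (ltW r0)) mulrBr mulrA.
exists q'; split => // x.
  have : q' x <= g 0 x by apply: (q'g); exists 0; rewrite /= ?lexx.
  by rewrite /g of_real0 scale0r addr0 mul0r subr0.
have : q' x <= g 1 x by apply: (q'g); exists 1; rewrite /= ?ler01.
by rewrite /g of_real1 scale1r mul1r.
Qed.

(** A minimal sublinear functional is additive, since it coincides with all its
    pushes; pushing towards [- z] beforehand makes it attain [p z]. *)
Lemma hahn_banach p z : sublinear p ->
  exists u, [/\ forall x y, u (x + y) = u x + u y,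
    forall r x, u (of_real r *: x) = r * u x,
    forall x, u x <= p x & p z <= u z].
Proof.
move=> sp; have [p' [sp' p'p p'z]] := sublinear_push z sp.
have [u [su up' umin]] := minimal_sublinear sp'.
have uD x y : u (x + y) = u x + u y.
  apply/le_anti; rewrite su.1 /= -lerBrDr.
  have [u' [su' u'u u'y]] := sublinear_push y su.
  by rewrite -{1}(umin _ su' u'u).
have uN x : u (- x) = - u x.
  have := uD x (- x); rewrite subrr sublinear0//; lra.
exists u; split => //.
- move=> r x; have [r0|r0] := leP 0 r; first exact: sublinearZ.
  have := @sublinearZ u (- r) x su; rewrite oppr_ge0 (ltW r0) => /(_ isT).
  by rewrite of_realN scaleNr uN mulNr => /oppr_inj.
- by move=> x; exact: le_trans (up' x) (p'p x).
- have := p'z (- z); rewrite addNr sublinear0// sub0r.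
  have := up' (- z); rewrite uN; lra.
Qed.
End HahnBanach.


(** * Spaces of sequences with block norms *)

Section BlockNorm.
Context {R : realType} {s : scalars} (E : banachType R s) (B : nat -> seq nat).
Local Notation K := (scalar_field R s).
Implicit Types (z : nat -> E).

(** The index [k] itself belongs to the [k]-th block, so the supremum of the
    block sums dominates every coordinate. Empty [B k] give the norm of
    [l_oo(E)], and [B k = iota 0 k] gives the partial sums of the norm of
    [l_1(E)]. *)
Definition block_sum z (k : nat) : R := \sum_(i <- k :: B k) rnorm (z i).

Lemma block_sum_ge0 z k : 0 <= block_sum z k.
Proof. by apply: sumr_ge0 => i _; exact: rnorm_ge0. Qed.

Lemma block_sumD z z' k : block_sum (z + z') k <= block_sum z k + block_sum z' k.
Proof. by rewrite /block_sum -big_split ler_sum// => i _; exact: rnormD. Qed.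

Lemma block_sumZ (a : K) z k :
  block_sum (a *: z) k = rnorm (a : K^o) * block_sum z k.
Proof. by rewrite /block_sum mulr_sumr; apply: eq_bigr => i _; exact: rnormZ. Qed.

Definition block_bounded : {pred (nat -> E)} :=
  fun z => `[< exists C : R, forall k, block_sum z k <= C >].

Record block_space := BlockSpace {
  block_seq :> nat -> E;
  block_spaceP : block_seq \in block_bounded }.

HB.instance Definition _ := [isSub for block_seq].
HB.instance Definition _ := [Choice of block_space by <:].

Lemma block_submod_closed : submod_closed block_bounded.
Proof.
split.
  apply/asboolP; exists 0 => k.
  by rewrite /block_sum big1// => i _; rewrite rnorm0.
move=> a x y /asboolP[C hC] /asboolP[D hD]; apply/asboolP.
exists (rnorm (a : K^o) * C + D) => k; rewrite (le_trans (block_sumD _ _ _))//.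
by rewrite lerD// block_sumZ ler_wpM2l// rnorm_ge0.
Qed.

HB.instance Definition _ :=
  GRing.isSubmodClosed.Build _ _ block_bounded block_submod_closed.
HB.instance Definition _ := [SubChoice_isSubLmodule of block_space by <:].

Lemma block_spaceD (x y : block_space) : block_seq (x + y) = block_seq x + block_seq y.
Proof. by []. Qed.
Lemma block_spaceZ a (x : block_space) : block_seq (a *: x) = a *: block_seq x.
Proof. by []. Qed.
Lemma block_spaceB (x y : block_space) : block_seq (x - y) = block_seq x - block_seq y.
Proof. by []. Qed.

Definition block_norm (x : block_space) : R := sup (range (block_sum x)).

Lemma block_sum_le_norm (x : block_space) k : block_sum x k <= block_norm x.
Proof.
apply: ub_le_sup; last by exists k.
by have /asboolP[C hC] := block_spaceP x; exists C => _ [j _ <-]; exact: hC.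
Qed.

Lemma block_norm_le (x : block_space) (C : R) :
  (forall k, block_sum x k <= C) -> block_norm x <= C.
Proof.
by move=> h; apply: ge_sup => [|_ [k _ <-]//]; exists (block_sum x 0%N), 0%N.
Qed.

Let norm (x : block_space) : K := of_real (block_norm x).

Let normD x y : norm (x + y) <= norm x + norm y.
Proof.
rewrite /norm -of_realD of_real_le; apply: block_norm_le => k.
by rewrite (le_trans (block_sumD _ _ _))// lerD// block_sum_le_norm.
Qed.

Let normZ (a : K) x : norm (a *: x) = `|a| * norm x.
Proof.
rewrite /norm [`|a|](@normE_rnorm _ _ K^o a) -of_realM; congr of_real.
have le_normZ (b : K) y : block_norm (b *: y) <= rnorm (b : K^o) * block_norm y.
  apply: block_norm_le => k; rewrite block_sumZ ler_wpM2l ?rnorm_ge0//.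
  exact: block_sum_le_norm.
apply/le_anti; rewrite le_normZ/=.
have [->|a0] := eqVneq a 0.
  rewrite rnorm0 mul0r (le_trans (block_sum_ge0 (0 *: x) 0%N))//.
  exact: block_sum_le_norm.
have := le_normZ a^-1 (a *: x); rewrite scalerA mulVf// scale1r => h.
have a1 : rnorm (a : K^o) * rnorm (a^-1 : K^o) = 1.
  by rewrite -rnormM mulfV// -(@of_real1 R s) rnorm_of_real normr1.
by rewrite (le_trans (ler_wpM2l (rnorm_ge0 _) h))// mulrA a1 mul1r.
Qed.

Let norm_eq0 x : norm x = 0 -> x = 0.
Proof.
move=> /(congr1 (@scalar_re R s)); rewrite of_realK -(@of_real0 R s) of_realK => x0.
apply: val_inj; apply/funext => i /=; apply: rnorm0_eq0.
apply/le_anti; rewrite rnorm_ge0 andbT -x0 (le_trans _ (block_sum_le_norm x i))//.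
by rewrite /block_sum big_cons lerDl sumr_ge0// => j _; exact: rnorm_ge0.
Qed.

HB.instance Definition _ :=
  Lmodule_isNormed.Build K block_space normD normZ norm_eq0.

Lemma rnorm_blockE (x : block_space) : rnorm x = block_norm x.
Proof. by rewrite /rnorm of_realK. Qed.

Lemma block_sum_le_rnorm (x : block_space) k : block_sum x k <= rnorm x.
Proof. by rewrite rnorm_blockE block_sum_le_norm. Qed.

Lemma rnorm_block_le (x : block_space) (C : R) :
  (forall k, block_sum x k <= C) -> rnorm x <= C.
Proof. by rewrite rnorm_blockE; exact: block_norm_le. Qed.

Lemma rnorm_coord_le (x : block_space) i : rnorm (x i) <= rnorm x.
Proof.
rewrite (le_trans _ (block_sum_le_rnorm x i))// /block_sum big_cons lerDl.
by rewrite sumr_ge0// => j _; exact: rnorm_ge0.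
Qed.

(** Coordinates converge because [E] is complete, and each block sum, involving
    finitely many coordinates, passes to the limit. *)
Lemma block_space_complete (F : set_system block_space) :
  ProperFilter F -> cauchy F -> cvg F.
Proof.
move=> FF /cauchy_ballP cF.
have {}cF (e : R) : 0 < e -> exists2 A, F A & forall x y, A x -> A y -> rnorm (x - y) < e.
  move=> e0; have /cF : 0 < of_real e :> K by rewrite -of_real0 of_real_lt.
  move=> [[A A'] /= [FA FA'] AA'].
  exists (A `&` A'); first exact: filterI.
  move=> x y [Ax _] [_ A'y]; have /= := AA' (x, y) (conj Ax A'y).
  by rewrite -ball_normE /= normE_rnorm of_real_lt.
have cvg_coord i : cvg ((fun x : block_space => x i) @ F).
  apply: cauchy_cvg; apply/cauchy_ballP => e e0.
  have eE : e = of_real (scalar_re e) by rewrite of_real_ge0K// ltW.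
  move: e0; rewrite eE -{1}of_real0 of_real_lt => /cF [A FA hA].
  pose ev (x : block_space) := x i.
  exists (ev @` A, ev @` A).
    have FA' : F (ev @^-1` (ev @` A)) by apply: filterS FA => x Ax; exists x.
    by split; exact: FA'.
  move=> [_ _] /= [[x Ax <-] [y Ay <-]].
  rewrite -ball_normE /= normE_rnorm of_real_lt (le_lt_trans _ (hA x y Ax Ay))//.
  exact: (rnorm_coord_le (x - y)).
pose a i : E := lim ((fun x : block_space => x i) @ F).
have near_a (l : seq nat) (e : R) : 0 < e ->
    \forall x \near F, \sum_(i <- l) rnorm (a i - (x : block_space) i) < e.
  elim: l e => [|i l IH] e e0; first by apply: nearW => x; rewrite big_nil.
  have e2 : 0 < e / 2 by rewrite divr_gt0.
  have h : F [set x : block_space | rnorm (a i - x i) < e / 2].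
    exact: ((cvg_rnormP (FF := fmap_filter (fun x : block_space => x i) _) (a i)).1
      (cvg_coord i) _ e2).
  apply: filterS2 (IH _ e2) h => x h1 h2.
  by rewrite big_cons [e]splitr ltrD.
have close (e : R) : 0 < e -> \forall x \near F,
    forall k, block_sum (a - block_seq x) k <= e.
  move=> e0; have [A FA hA] := cF _ e0.
  apply: (filterS _ FA) => x Ax k; apply/ler_addgt0Pr => d d0.
  have [y [Ay yd]] := filter_ex (filterI FA (near_a (k :: B k) _ d0)).
  rewrite (_ : a - block_seq x = (a - block_seq y) + block_seq (y - x)); last first.
    by rewrite block_spaceB addrA subrK.
  rewrite (le_trans (block_sumD _ _ _))// addrC lerD ?ltW//.
  exact: le_lt_trans (block_sum_le_rnorm _ _) (hA _ _ Ay Ax).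
have ab : a \in block_bounded.
  have [x hx] := filter_ex (close _ ltr01); apply/asboolP; exists (1 + rnorm x) => k.
  rewrite -(subrK (block_seq x) a) (le_trans (block_sumD _ _ _))// lerD//.
  exact: block_sum_le_rnorm.
apply/cvg_ex; exists (BlockSpace ab); apply/cvg_rnormP => e e0.
have e2 : 0 < e / 2 by rewrite divr_gt0.
apply: filterS (close _ e2) => x hx.
by rewrite (le_lt_trans (@rnorm_block_le (BlockSpace ab - x) _ hx))// ltr_pdivrMr// ltr_pMr// ltr1n.
Qed.

HB.instance Definition _ :=
  Uniform_isComplete.Build block_space block_space_complete.

Definition block_banach : banachType R s := block_space.

End BlockNorm.
Arguments block_bounded {R s} E B _.


(** * Finite rank operators *)

Section LinearOf.
Context {K : numFieldType} {V W : lmodType K} (f : V -> W) (fL : linear f).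

Let fS : GRing.isLinear K V W *:%R f := GRing.isLinear.Build K V W *:%R f fL.

Definition linear_of : {linear V -> W} := HB.pack f fS.
End LinearOf.

Section FiniteRank.
Context {R : realType} {s : scalars}.
Local Notation K := (scalar_field R s).

(** Finite rank is expressed by a range equal to the span of finitely many
    vectors; this lemma allows a range that is merely contained in one. By
    induction on the number of vectors: a vector [w] of [W] with nonzero first
    coordinate reduces every vector of [W], modulo the line of [w], to one in the
    span of the remaining vectors. *)
Lemma subspace_of_span (Y : lmodType K) (n : nat) (e : 'I_n -> Y) (W : set Y) :
  W 0 -> (forall a x y, W x -> W y -> W (a *: x + y)) ->
  W `<=` range (fun c : 'I_n -> K => \sum_i c i *: e i) ->
  exists m (e' : 'I_m -> Y), W = range (fun c : 'I_m -> K => \sum_i c i *: e' i).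
Proof.
elim: n e W => [|n IH] e W W0 WL We.
  exists 0%N, e; apply/seteqP; split => // _ [c _ <-].
  by rewrite big_ord0.
pose e0 := fun i : 'I_n => e (lift ord0 i).
pose W' := W `&` range (fun c : 'I_n -> K => \sum_i c i *: e0 i).
have W'L a x y : W' x -> W' y -> W' (a *: x + y).
  move=> [Wx [c _ cE]] [Wy [d _ dE]]; split; first exact: WL.
  exists (fun i => a * c i + d i) => //; rewrite -cE -dE scaler_sumr -big_split.
  by apply: eq_bigr => i _; rewrite /= scalerDl scalerA.
have W'0 : W' 0.
  split => //; exists (fun=> 0) => //; rewrite big1// => i _.
  by rewrite scale0r.
have [m [e' W'E]] := IH e0 W' W'0 W'L (fun _ h => h.2).
have [WW'|] := pselect (W `<=` W').
  by exists m, e'; rewrite -W'E; apply/seteqP; split => // x [].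
move=> /existsNP[w /not_implyP[Ww nW'w]].
have [c _ wE] := We _ Ww; rewrite big_ord_recl in wE.
have c0 : c ord0 != 0.
  apply/eqP => c0; apply: nW'w; split => //; exists (fun i => c (lift ord0 i)) => //.
  by rewrite -wE c0 scale0r add0r.
exists m.+1, (fun i => if unlift ord0 i is Some j then e' j else w).
apply/seteqP; split => [v Wv|_ [d _ <-]]; last first.
  rewrite big_ord_recl unlift_none; apply: WL => //.
  have : W' (\sum_(i < m) d (lift ord0 i) *: e' i).
    by rewrite W'E; exists (fun i => d (lift ord0 i)).
  by case=> + _; congr W; apply: eq_bigr => i _; rewrite liftK.
have [d _ vE] := We _ Wv; rewrite big_ord_recl in vE.
pose t := d ord0 / c ord0.
have : W' (- t *: w + v).
  split; first exact: WL.
  exists (fun i => - t * c (lift ord0 i) + d (lift ord0 i)) => //.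
  rewrite -wE -vE scalerDr addrACA !scalerA mulNr divfK// -scalerDl addNr scale0r add0r.
  rewrite scaler_sumr -big_split; apply: eq_bigr => i _ /=.
  by rewrite scalerDl !scalerA.
rewrite W'E => -[b _ bE].
exists (fun i => if unlift ord0 i is Some j then b j else t) => //.
rewrite big_ord_recl unlift_none.
under eq_bigr do rewrite liftK.
by rewrite bE scaleNr addrA subrr add0r.
Qed.

Lemma finite_rankP (X Y : normedModType K) (T : {linear X -> Y}) :
  finite_rank T <-> continuous T /\ exists n (e : 'I_n -> Y),
    forall x, exists c : 'I_n -> K, T x = \sum_i c i *: e i.
Proof.
split=> [[cT [n [e Te]]]|[cT [n [e Te]]]]; split => //.
  exists n, e => x; have : range T (T x) by exists x.
  by rewrite Te => -[c _ cE]; exists c.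
apply: (@subspace_of_span _ _ e).
- by exists 0 => //; rewrite linear0.
- by move=> a _ _ [x _ <-] [y _ <-]; exists (a *: x + y) => //; rewrite linearP.
- by move=> _ [x _ <-]; have [c cE] := Te x; exists c.
Qed.

Lemma finite_rank0 (X Y : normedModType K) : finite_rank (\0 : {linear X -> Y}).
Proof.
apply/finite_rankP; split.
  by apply/linear_continuousP; exists 0; split => // x; rewrite rnorm0 mul0r.
by exists 0%N, (fun=> 0) => x; exists (fun=> 0); rewrite big_ord0.
Qed.

Lemma finite_rankD (X Y : normedModType K) (T U : {linear X -> Y}) :
  finite_rank T -> finite_rank U -> finite_rank (T \+ U).
Proof.
move=> /finite_rankP[cT [n [e Te]]] /finite_rankP[cU [m [f Uf]]].
apply/finite_rankP; split.
  by move=> x; apply: cvgD; [exact: cT|exact: cU].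
exists (n + m)%N, (fun i => match fintype.split i with inl j => e j | inr j => f j end).
move=> x; have [c cE] := Te x; have [d dE] := Uf x.
exists (fun i => match fintype.split i with inl j => c j | inr j => d j end).
rewrite big_split_ord /= cE dE; congr (_ + _); apply: eq_bigr => i _.
  by rewrite (unsplitK (inl i)).
by rewrite (unsplitK (inr i)).
Qed.

Lemma finite_rankZ (X Y : normedModType K) (a : K) (T : {linear X -> Y}) :
  finite_rank T -> finite_rank (a \*: T).
Proof.
move=> /finite_rankP[cT [n [e Te]]]; apply/finite_rankP; split.
  by move=> x; apply: cvgZr; exact: cT.
exists n, e => x; have [c cE] := Te x; exists (fun i => a * c i).
by rewrite /= cE scaler_sumr; apply: eq_bigr => i _; rewrite scalerA.
Qed.

Section PartialSum.
Context {X Y : normedModType K} (f : nat -> {linear X -> K^o}) (y : nat -> Y).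

Lemma partial_sum_is_linear n :
  linear (fun x => \sum_(i < n) (f i x : K) *: y i).
Proof.
move=> a x x'; rewrite scaler_sumr -big_split; apply: eq_bigr => i _ /=.
by rewrite linearP scalerDl scalerA.
Qed.

Definition partial_sum n : {linear X -> Y} := linear_of (partial_sum_is_linear n).

Lemma finite_rank_partial_sum n : (forall i, continuous (f i)) ->
  finite_rank (partial_sum n).
Proof.
move=> cf; apply/finite_rankP; split; last first.
  by exists n, (fun i => y i) => x; exists (fun i => f i x).
apply/linear_continuousP.
exists (\sum_(i < n) fine (opnorm (f i)) * rnorm (y i)); split.
  by apply: sumr_ge0 => i _; rewrite mulr_ge0 ?rnorm_ge0 ?fine_opnorm_ge0.
move=> x; rewrite (le_trans (rnorm_sum _ _))// mulr_suml ler_sum// => i _.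
rewrite rnormZ mulrAC ler_wpM2r ?rnorm_ge0//.
exact: rnorm_le_fine_opnorm.
Qed.
End PartialSum.

End FiniteRank.


(** * Compact sets and the approximation property *)

Section Nets.
Variable I : directed_set.

#[global] Instance net_filter_proper : ProperFilter (net_filter I).
Proof.
apply: filter_from_proper; last by move=> i _; exists i; exact: dir_refl.
apply: filter_from_filter; first by case: (dir_inhabited I) => i; exists i.
move=> i j _ _; have [k [ik jk]] := dir_upper i j; exists k => // l kl.
by split; [exact: dir_trans ik kl|exact: dir_trans jk kl].
Qed.
End Nets.

Section Compactness.
Context {R : realType} {s : scalars}.
Local Notation K := (scalar_field R s).

Lemma compact_finite_net (X : normedModType K) (A : set X) (r : R) :
  compact A -> 0 < r ->
  exists l : seq X, forall x, A x -> exists2 a, a \in l & rnorm (x - a) < r.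
Proof.
rewrite compact_cover => cA r0.
have r0' : 0 < of_real r :> K by rewrite -of_real0 of_real_lt.
have [|x Ax|D _ AD] := cA X setT (fun a => ball a (of_real r)).
- by move=> a _; exact: ball_open.
- by exists x => //; exact: ballxx.
exists (finmap.enum_fset D) => x /AD[a /= aD].
rewrite -ball_normE /= normE_rnorm of_real_lt rnormBC => xa.
by exists a.
Qed.

Lemma half_pow_lt (e : R) : 0 < e -> exists k, (2 : R)^-1 ^+ k < e.
Proof.
move=> e0; have : ((2 : R)^-1 ^+ k) @[k --> \oo] --> 0.
  by apply: cvg_expr; rewrite ger0_norm ?invf_lt1 ?invr_ge0 ?ltr1n.
move=> /cvgrPdist_lt/(_ e e0)[k _ /(_ k)].
rewrite /= leqnn sub0r normrN => /(_ isT).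
by rewrite ger0_norm ?exprn_ge0 ?invr_ge0//; exists k.
Qed.

(** Enumerating the pairs (block, position) keeps each block within finitely
    many indices, whence the tail statement. *)
Lemma enumerate_blocks (X : nmodType) (L : nat -> seq X) :
  exists x : nat -> X,
    (forall k a, a \in L k -> exists n, x n = a) /\
    (forall k0, \forall n \near \oo,
       x n = 0 \/ exists2 k, (k0 <= k)%N & x n \in L k).
Proof.
pose x n := if (pickle_inv n : option (nat * nat)) is Some p then nth 0 (L p.1) p.2 else 0.
exists x; split => [k a ak|k0].
  exists (pickle (k, index a (L k))); rewrite /x pickleK_inv /=.
  exact: nth_index.
(* The largest index that codes a position in one of the first k0 blocks. *)
pose N := (\max_(k < k0) \max_(j < size (L k)) pickle (nat_of_ord k, nat_of_ord j))%N.
exists N.+1 => // n /= Nn; rewrite /x.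
case E : (pickle_inv n) => [[k j]|]; last by left.
have [kk0|k0k] := ltnP k k0; last first.
  have [jL|Lj] := ltnP j (size (L k)); last by left; rewrite nth_default.
  by right; exists k => //; exact: mem_nth.
left; have [jL|Lj] := ltnP j (size (L k)); last by rewrite nth_default.
have nE : pickle (k, j) = n by have := @pickle_invK (nat * nat)%type n; rewrite E /=.
suff : (n <= N)%N by rewrite leqNgt Nn.
rewrite -nE (leq_trans _ (leq_bigmax (Ordinal kk0)))//=.
exact: (leq_bigmax (Ordinal jL)).
Qed.

(** Grothendieck's description of compact sets, in the form that is used:
    differences of successive [4^-k]-nets, scaled by [2^k], still tend to zero,
    and telescoping along the nets recovers every point of the compact set. *)
Lemma compact_null_sequence (X : normedModType K) (A : set X) : compact A ->
  exists x : nat -> X, x @ \oo --> 0 /\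
    forall (S : {linear X -> X}) (e : R), continuous S ->
      (forall n, rnorm (x n - S (x n)) <= e) ->
      forall z, A z -> rnorm (z - S z) <= 2 * e.
Proof.
move=> cA.
pose h : R := 2^-1.
have h0 : 0 < h by rewrite invr_gt0.
have hk0 k : 0 < h ^+ k by rewrite exprn_gt0.
have [net netP] := choice (fun k => compact_finite_net cA (exprn_gt0 2 (hk0 k))).
pose L k := if k is j.+1 then
    [seq a <- [seq of_real (h ^+ k)^-1 *: (b - c) | b <- net k, c <- net j]
       | rnorm a <= 8 * h ^+ k]
  else net 0%N.
have [x [xL x0]] := enumerate_blocks L.
exists x; split.
  apply/cvg_rnormP => e e0.
  have [k0 k0e] : exists k, h ^+ k < e / 8 by apply: half_pow_lt; rewrite divr_gt0.
  apply: filterS (x0 k0.+1) => n xn /=.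
  case: xn => [->|[[//|k] k0k]]; first by rewrite subrr rnorm0.
  rewrite mem_filter => /andP[+ _]; rewrite sub0r rnormN => /le_lt_trans; apply.
  rewrite mulrC -ltr_pdivlMr// (le_lt_trans _ k0e)// ler_wiXn2l ?(ltW h0)//.
    by rewrite invf_le1 ?ler1n.
  exact: ltnW.
move=> S e cS xS z Az.
have [d dP] := choice (fun k => (exists2P _ _).1 (netP k z Az)).
(* At depth k the errors add up to e * (1 + 1/2 + ... + 2^-k). *)
have tele k : rnorm (d k - S (d k)) <= (2 - h ^+ k) * e.
  elim: k => [|k IH].
    have [/(xL 0%N)[n <-] _] := dP 0%N.
    by rewrite (_ : 2 - _ = 1) ?mul1r//; rewrite expr0; lra.
  (* The scaled difference of consecutive net points is a term of the sequence;
     the bound 5 * h ^+ k.+1 on its norm is below the threshold 8 * h ^+ k.+1. *)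
  pose a := of_real (h ^+ k.+1)^-1 *: (d k.+1 - d k).
  have hn0 : h ^+ k.+1 != 0 by rewrite gt_eqF.
  have aE : d k.+1 - d k = of_real (h ^+ k.+1) *: a.
    by rewrite scalerA -of_realM mulfV// of_real1 scale1r.
  have aL : a \in L k.+1.
    have [dk zdk] := dP k; have [dk1 zdk1] := dP k.+1.
    rewrite mem_filter; apply/andP; split; last first.
      by apply/allpairsP; exists (d k.+1, d k).
    rewrite rnormZr ger0_norm ?invr_ge0 ?(ltW (hk0 _))// ler_pdivrMl//.
    rewrite (le_trans (rnorm_distD z _ _))// rnormBC.
    rewrite (le_trans (lerD (ltW zdk1) (ltW zdk)))//.
    rewrite [h ^+ k.+1]exprS; move: (h ^+ k) => p; rewrite /h; have := sqr_ge0 p; lra.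
  have [n xa] := xL _ _ aL.
  have -> : d k.+1 - S (d k.+1) = (d k - S (d k)) + of_real (h ^+ k.+1) *: (a - S a).
    rewrite scalerBr -(linearZ_LR S) -aE linearB /= opprB addrACA.
    by rewrite subrKC addKr.
  rewrite (le_trans (rnormD _ _))// rnormZr gtr0_norm// -xa.
  rewrite (le_trans (lerD IH (ler_wpM2l (ltW (hk0 k.+1)) (xS n))))//.
  rewrite -mulrDl ler_wpM2r//; first exact: le_trans (rnorm_ge0 _) (xS 0%N).
  by rewrite exprS /h; lra.
have [C [C0 SC]] := (linear_continuousP S).1 cS.
have e0 : 0 <= e by exact: le_trans (rnorm_ge0 _) (xS 0%N).
apply/ler_addgt0Pr => t t0.
have C1 : 0 < 1 + C by rewrite ltr_pwDl.
have [k kt] : exists k, h ^+ k < t / (1 + C) by apply: half_pow_lt; rewrite divr_gt0.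
have [_ zdk] := dP k.
have zk : rnorm (z - d k) <= h ^+ k.
  rewrite (le_trans (ltW zdk))// expr2 ler_piMr ?(ltW (hk0 k))//.
  by rewrite exprn_ile1 ?(ltW h0)// invf_le1 ?ler1n.
have -> : z - S z = (d k - S (d k)) + ((z - d k) - S (z - d k)).
  by rewrite linearB opprB addrACA subrKC addKr.
rewrite (le_trans (rnormD _ _))// lerD//.
  rewrite (le_trans (tele k))// ler_wpM2r// gerBl; exact: ltW.
rewrite (le_trans (rnormB _ _))// (le_trans (lerD zk (SC _)))//.
rewrite (le_trans (lerD (lexx _) (ler_wpM2l C0 zk)))//.
by rewrite -[X in X + _]mul1r -mulrDl -ler_pdivlMl// mulrC ltW.
Qed.

(** The net is indexed by a compact set together with a tolerance. *)
Lemma approximation_property_of_compact (X : banachType R s) :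
  (forall (A : set X) (e : R), compact A -> 0 < e ->
     exists2 S : {linear X -> X}, finite_rank S &
       forall x, A x -> rnorm (x - S x) <= e) ->
  approximation_property X.
Proof.
move=> apX.
pose I := ({A : set X | compact A} * nat)%type.
pose le (i j : I) := (sval i.1 `<=` sval j.1) /\ (i.2 <= j.2)%N.
have I0 : inhabited I by constructor; exact: (exist _ set0 compact0, 0%N).
have leR i : le i i by split.
have leT i j k : le i j -> le j k -> le i k.
  by move=> [ij ij'] [jk jk']; split; [exact: (subset_trans ij jk)|exact: (leq_trans ij' jk')].
have leU i j : exists k, le i k /\ le j k.
  exists (exist _ _ (compactU (svalP i.1) (svalP j.1)), maxn i.2 j.2).
  by split; split => /=; [exact: subsetUl|exact: leq_maxl|exact: subsetUr|exact: leq_maxr].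
pose D := DirectedSet I0 leR leT leU.
have hk k : 0 < (2 : R)^-1 ^+ k by rewrite exprn_gt0// invr_gt0.
have [S SP] := choice (fun i : I => (exists2P _ _).1 (apX _ _ (svalP i.1) (hk i.2))).
exists D, S; split => [i|]; first exact: (SP i).1.
apply/fam_cvgP => A cA P /uniform_nbhs[E [entE EP]].
have [e /= e0 eE] : exists2 e : K, 0 < e & [set xy : X * X | ball xy.1 e xy.2] `<=` E.
  by move: entE; rewrite -entourage_ballE => -[e e0 eE]; exists e.
have eR : e = of_real (scalar_re e) by rewrite of_real_ge0K// ltW.
move: e0; rewrite eR -of_real0 of_real_lt => /half_pow_lt[n ne].
exists ((exist _ A cA, n) : I) => // -[[A' cA'] n'] [/= AA' nn'].
apply: EP => x Ax; apply: eE; rewrite -ball_normE /= eR normE_rnorm of_real_lt.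
have := (SP (exist _ A' cA', n')).2 x (AA' x Ax).
move=> /le_lt_trans; apply; rewrite (le_lt_trans _ ne)//=.
by rewrite ler_wiXn2l ?invr_ge0// invf_le1 ?ler1n.
Qed.
End Compactness.


(** * The functional produced by failure of the approximation property *)

Lemma eventually_le1_bounded {R : realType} (c : nat -> R) :
  (forall n, 0 <= c n) -> (\forall n \near \oo, c n <= 1) ->
  exists C, forall n, c n <= C.
Proof.
move=> c0 [N _ cN]; exists (1 + \sum_(n < N) c n) => n.
have [nN|Nn] := ltnP n N; last by rewrite (le_trans (cN n Nn))// lerDl sumr_ge0.
by rewrite (bigD1 (Ordinal nN))//= addrCA lerDl addr_ge0// sumr_ge0.
Qed.

Section SingleEntry.
Context {R : realType} {s : scalars} {X : banachType R s} {B : nat -> seq nat}.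
Hypothesis uB : forall k, uniq (k :: B k).
Local Notation K := (scalar_field R s).

Definition single_fun n (z : X) (i : nat) : X := if i == n then z else 0.

Lemma block_sum_single n z k : block_sum B (single_fun n z) k <= rnorm z.
Proof.
rewrite /block_sum; move: (k :: B k) (uB k) => l ul.
have [nl|nl] := boolP (n \in l).
  rewrite (bigD1_seq n)//= /single_fun eqxx big1 ?addr0// => i /negPf ->.
  by rewrite rnorm0.
rewrite big_seq big1 ?rnorm_ge0// => i il; rewrite /single_fun.
by case: eqP => [iE|_]; [rewrite -iE il in nl|rewrite rnorm0].
Qed.

Lemma single_bounded n z : single_fun n z \in block_bounded X B.
Proof. by apply/asboolP; exists (rnorm z) => k; exact: block_sum_single. Qed.

Definition single n (z : X) : block_banach X B := BlockSpace (single_bounded n z).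

Lemma rnorm_single_le n z : rnorm (single n z) <= rnorm z.
Proof. by apply: rnorm_block_le => k; exact: block_sum_single. Qed.

Lemma single_is_linear n : linear (single n).
Proof.
move=> a x y; apply: val_inj; apply/funext => i /=.
change (single_fun n (a *: x + y) i = a *: single_fun n x i + single_fun n y i).
by rewrite /single_fun; case: ifP => // _; rewrite scaler0 addr0.
Qed.

Lemma sum_singleE (z : nat -> X) N i :
  block_seq (\sum_(n < N) single n (z n)) i = if (i < N)%N then z i else 0.
Proof.
elim: N => [|N IH]; first by rewrite big_ord0.
rewrite big_ord_recr block_spaceD.
change (block_seq (\sum_(n < N) single n (z n)) i + single_fun N (z N) i =
  if (i < N.+1)%N then z i else 0).
rewrite IH /single_fun ltnS; case: ltngtP => [||->]; rewrite ?addr0 ?add0r//.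
Qed.
End SingleEntry.

Section BoundedSequences.
Context {R : realType} {s : scalars} {X : banachType R s}.
Local Notation K := (scalar_field R s).

Lemma uniq_singleton (k : nat) : uniq (k :: [::]). Proof. by []. Qed.

Local Notation bsingle := (single (X := X) (B := fun=> [::]) uniq_singleton).

Definition bounded_seq : banachType R s := block_banach X (fun=> [::]).

Lemma bounded_seqP (z : nat -> X) (C : R) : (forall n, rnorm (z n) <= C) ->
  exists w : bounded_seq, block_seq w = z.
Proof.
move=> zC; have zb : z \in block_bounded X (fun=> [::]).
  by apply/asboolP; exists C => k; rewrite /block_sum big_seq1.
by exists (BlockSpace zb).
Qed.

Lemma rnorm_bounded_le (z : bounded_seq) (C : R) :
  (forall n, rnorm (block_seq z n) <= C) -> rnorm z <= C.
Proof.
by move=> zC; apply: rnorm_block_le => k; rewrite /block_sum big_seq1.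
Qed.

(** On sequences tending to zero, a bounded functional is determined by its
    coordinates, because finitely supported truncations converge in the
    supremum norm. *)
Lemma null_seq_functional (f : bounded_seq -> K) (z : bounded_seq) :
  linear f -> (forall w, rnorm (f w : K^o) <= rnorm w) ->
  block_seq z @ \oo --> 0 ->
  forall e : R, 0 < e -> \forall N \near \oo,
    rnorm (f z - \sum_(n < N) f (bsingle n (block_seq z n)) : K^o) <= e.
Proof.
move=> fL f1 z0 e e0; have [N0 _ N0P] := (cvg_rnormP 0).1 z0 e e0.
exists N0 => // N /= N0N.
pose fl := linear_of (W := K^o) fL.
rewrite -[f z]/(fl z).
rewrite -(raddf_sum fl) -raddfB /= (le_trans (f1 _))//.
apply: rnorm_bounded_le => i.
rewrite block_spaceB.
change (rnorm (block_seq z i - block_seq (\sum_(n < N) bsingle n (block_seq z n)) i) <= e).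
rewrite sum_singleE; case: ltnP => [_|Ni]; first by rewrite subrr rnorm0 ltW.
have := N0P i (leq_trans N0N Ni); rewrite /= sub0r rnormN subr0; exact: ltW.
Qed.

Lemma coordinate_is_linear (f : bounded_seq -> K) (fL : linear f) n :
  linear (fun z => f (bsingle n z) : K^o).
Proof. by move=> a x y; rewrite single_is_linear fL. Qed.

Definition coordinate (f : bounded_seq -> K) (fL : linear f) n :
  {linear X -> K^o} := linear_of (coordinate_is_linear fL n).

Lemma coordinate_le (f : bounded_seq -> K) (fL : linear f) n z :
  (forall w, rnorm (f w : K^o) <= rnorm w) ->
  rnorm (coordinate fL n z) <= 1 * rnorm z.
Proof.
move=> f1; rewrite mul1r (le_trans (f1 _))//; exact: rnorm_single_le.
Qed.

(** The coordinates of a bounded functional are summable in norm: test it on a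
    sequence of almost norming vectors with aligned phases. *)
Lemma coordinate_summable (f : bounded_seq -> K) (fL : linear f) N :
  (forall w, rnorm (f w : K^o) <= rnorm w) ->
  \sum_(n < N) fine (opnorm (coordinate fL n)) <= 1.
Proof.
move=> f1; have cc n : continuous (coordinate fL n).
  by apply/linear_continuousP; exists 1; split => // z; exact: coordinate_le.
apply/ler_addgt0Pr => e e0.
pose d := e / N.+1%:R.
have d0 : 0 < d by rewrite divr_gt0.
have norming n : exists z, rnorm z <= 1 /\
    fine (opnorm (coordinate fL n)) - d <= scalar_re (coordinate fL n z).
  have : ((fine (opnorm (coordinate fL n)) - d)%:E < opnorm (coordinate fL n))%E.
    by rewrite [ltRHS]opnorm_fin// lte_fin ltrBlDr ltrDl.
  move=> /ereal_sup_gt[_ [z /= z1 <-]]; rewrite lte_fin => hz.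
  have [c [c1 cz]] := phase (coordinate fL n z).
  exists (c *: z); rewrite rnormZ c1 mul1r; split => //.
  have cE : coordinate fL n (c *: z) = of_real (rnorm (coordinate fL n z)).
    by rewrite -cz; exact: (linearZ_LR (coordinate fL n)).
  apply: (le_trans (ltW hz)).
  by rewrite -[leLHS](@of_realK R s) -cE.
have [z zP] := choice norming.
have sumD : \sum_(n < N) (fine (opnorm (coordinate fL n)) - d) <= 1.
  apply: (@le_trans _ _ (scalar_re (f (\sum_(n < N) bsingle n (z n))))).
    pose fl := linear_of (W := K^o) fL.
    rewrite -[f _]/(fl _) raddf_sum.
    rewrite (big_morph (@scalar_re R s) (@scalar_reD R s) (_ : _ = 0)); last first.
      by rewrite -(@of_real0 R s) of_realK.
    by apply: ler_sum => n _; exact: (zP n).2.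
  rewrite (le_trans (scalar_re_le_rnorm _))// (le_trans (f1 _))//.
  apply: rnorm_bounded_le => i; rewrite sum_singleE.
  by case: ifP => _; [exact: (zP i).1|rewrite rnorm0].
rewrite -lerBlDr (le_trans _ sumD)// big_split /= lerD2l sumrN lerN2.
rewrite sumr_const card_ord -[d *+ N]mulr_natr /d -mulrA ler_piMr ?(ltW e0)//.
by rewrite ler_pdivrMl// mulr1 ler_nat.
Qed.

End BoundedSequences.
Arguments bounded_seq {R s} X.

Section FailureFunctional.
Context {R : realType} {s : scalars} {X : banachType R s}.
Local Notation K := (scalar_field R s).

(** The subspace of the sequences [(S (x n))_n] lies at distance at least [e]
    from [x], so Hahn-Banach applies to the distance to it; phases turn the
    bound on the real part into one on the modulus. *)
Lemma separating_functional (x : nat -> X) (e : R) (C : R) : 0 < e ->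
  (forall n, rnorm (x n) <= C) ->
  (forall S : {linear X -> X}, finite_rank S ->
    exists n, e <= rnorm (x n - S (x n))) ->
  exists f : bounded_seq X -> K, [/\ linear f,
    forall w, rnorm (f w : K^o) <= rnorm w,
    forall (S : {linear X -> X}) (w : bounded_seq X), finite_rank S ->
      (forall n, block_seq w n = S (x n)) -> f w = 0 &
    forall w : bounded_seq X, block_seq w = x -> e <= rnorm (f w : K^o)].
Proof.
move=> e0 xC xS.
(* The infimum of G is the distance to the subspace of all (S (x n))_n, which is
   at least e at x. *)
pose G := [set g : bounded_seq X -> R | exists (S : {linear X -> X}) (w : bounded_seq X),
  [/\ finite_rank S, forall n, block_seq w n = S (x n) & g = (fun z => rnorm (z - w))]].
have seqS (S : {linear X -> X}) : finite_rank S ->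
    exists w : bounded_seq X, forall n, block_seq w n = S (x n).
  move=> [/linear_continuousP[D [D0 hD]] _].
  have [|w wE] := @bounded_seqP _ _ _ (fun n => S (x n)) (D * C).
    by move=> n; rewrite (le_trans (hD _))// ler_wpM2l.
  by exists w => n; rewrite wE.
have G0 : G (fun z => rnorm z).
  exists \0, 0; split; [exact: finite_rank0|by []|].
  by apply/funext => z; rewrite subr0.
have [||||q [sq qG qge]] := @inf_sublinear R s (bounded_seq X) G (fun=> 0).
- by exists (fun z => rnorm z).
- by move=> _ z [S [w [_ _ ->]]]; exact: rnorm_ge0.
- move=> _ _ z z' [S [w [fS wS ->]]] [S' [w' [fS' wS' ->]]].
  exists (fun y => rnorm (y - (w + w'))).
    exists (S \+ S'), (w + w'); split => //; first exact: finite_rankD.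
    move=> n; rewrite block_spaceD.
    by change (block_seq w n + block_seq w' n = (S \+ S') (x n)); rewrite wS wS'.
  by rewrite opprD addrACA rnormD.
- move=> _ r z [S [w [fS wS ->]]] r0.
  exists (fun y => rnorm (y - of_real r *: w)).
    exists (of_real r \*: S), (of_real r *: w); split => //; first exact: finite_rankZ.
    move=> n; rewrite block_spaceZ.
    by change (of_real r *: block_seq w n = (of_real r \*: S) (x n)); rewrite wS.
  by rewrite -scalerBr rnormZr gtr0_norm.
have [xw xwE] := bounded_seqP xC.
have [u [uD uZ uq ux]] := hahn_banach xw sq.
have ule w : u w <= rnorm w by rewrite (le_trans (uq w))// (qG _ _ G0).
have u0 (S : {linear X -> X}) w : finite_rank S ->
    (forall n, block_seq w n = S (x n)) -> u w <= 0.
  move=> fS wS; rewrite (le_trans (uq w))//.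
  have : G (fun z => rnorm (z - w)) by exists S, w.
  by move=> /(qG _ w); rewrite subrr rnorm0.
have [f [fL fu]] := complexify uD uZ.
have fZ c w : f (c *: w) = c * f w.
  exact: (linearZ_LR (linear_of (W := K^o) fL)).
exists f; split => //.
- move=> w; have [c [c1 cw]] := phase (f w).
  by rewrite -(@of_realK R s (rnorm (f w : K^o))) -cw -fZ fu (le_trans (ule _))// rnormZ c1 mul1r.
- move=> S w fS wS; have [c [c1 cw]] := phase (f w).
  apply: (@rnorm0_eq0 _ _ K^o); apply/le_anti; rewrite rnorm_ge0 andbT.
  rewrite -(@of_realK R s (rnorm (f w : K^o))) -cw -fZ fu.
  apply: (u0 (c \*: S)); first exact: finite_rankZ.
  move=> n; rewrite block_spaceZ.
  by change (c *: block_seq w n = (c \*: S) (x n)); rewrite wS.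
- move=> w wx; have -> : w = xw by apply: val_inj; rewrite /= wx -xwE.
  rewrite (le_trans _ (scalar_re_le_rnorm _))// fu (le_trans _ ux)//.
  apply: qge => _ [S [w' [fS wS ->]]]; have [n en] := xS S fS.
  rewrite (le_trans en)// -wS -xwE.
  exact: (@rnorm_coord_le _ _ X (fun=> [::]) (xw - w') n).
Qed.

(** Failure of approximation on a compact set becomes failure along a null
    sequence, where the separating functional is given by its coordinates
    because both [x] and its images under operators tend to zero. *)
Lemma approximation_property_failure : ~ approximation_property X ->
  exists (a : nat -> {linear X -> K^o}) (x : nat -> X) (d : R),
  [/\ forall n, continuous (a n), x @ \oo --> 0, 0 < d,
    forall N, \sum_(n < N) fine (opnorm (a n)) <= 1 &
    (forall (S : {linear X -> X}) (e : R), finite_rank S -> 0 < e ->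
      \forall N \near \oo, rnorm (\sum_(n < N) a n (S (x n)) : K^o) <= e) /\
    \forall N \near \oo, d <= rnorm (\sum_(n < N) a n (x n) : K^o)].
Proof.
move=> nAP.
have [A [e [cA e0 AP]]] : exists (A : set X) (e : R), [/\ compact A, 0 < e &
    forall S : {linear X -> X}, finite_rank S -> exists2 x, A x & e < rnorm (x - S x)].
  apply: contrapT => h; apply: nAP; apply: approximation_property_of_compact.
  move=> A e cA e0; apply: contrapT => h'; apply: h; exists A, e; split => // S fS.
  apply: contrapT => h''; apply: h'; exists S => // x Ax.
  by rewrite leNgt; apply/negP => ex; apply: h''; exists x.
have [x [x0 xS]] := compact_null_sequence cA.
have [C xC] : exists C, forall n, rnorm (x n) <= C.
  apply: eventually_le1_bounded => [n|]; first exact: rnorm_ge0.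
  have [N _ NP] := (cvg_rnormP 0).1 x0 1 ltr01; exists N => // n Nn.
  by have := NP n Nn; rewrite /= sub0r rnormN => /ltW.
have [|f [fL f1 fS fx]] := separating_functional (divr_gt0 e0 (ltr0n _ 2)) xC.
  move=> S fS; apply: contrapT => h.
  have [z Az] := AP S fS; rewrite ltNge => /negP; apply.
  rewrite (_ : e = 2 * (e / 2)); last by rewrite mulrCA divff ?mulr1.
  apply: (xS S _ fS.1) => // n; rewrite leNgt; apply/negP => hn; apply: h.
  by exists n; exact: ltW.
have cf n : continuous (coordinate fL n).
  by apply/linear_continuousP; exists 1; split => // z; exact: coordinate_le.
exists (fun n => coordinate fL n), x, (e / 2 / 2); split => //.
- by rewrite !divr_gt0.
- by move=> N; exact: coordinate_summable.
have [xw xwE] := bounded_seqP xC; split.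
- move=> S d fS' d0; have [D [D0 hD]] := (linear_continuousP S).1 fS'.1.
  have [|w wE] := @bounded_seqP _ _ _ (fun n => S (x n)) (D * C).
    by move=> n; rewrite (le_trans (hD _))// ler_wpM2l.
  have w0 : block_seq w @ \oo --> 0.
    rewrite wE -(linear0 S); apply: cvg_comp x0 _; exact: fS'.1.
  apply: filterS (null_seq_functional fL f1 w0 d0) => N.
  by rewrite (fS S w fS') ?wE// sub0r rnormN.
have xw0 : block_seq xw @ \oo --> 0 by rewrite xwE.
have e4 : 0 < e / 2 / 2 by rewrite !divr_gt0.
apply: filterS (null_seq_functional fL f1 xw0 e4) => N.
have := fx xw xwE; rewrite xwE.
set t : K^o := \sum_(_ < _) _ => hf ht.
have := @rnormD _ _ K^o (f xw - t) t; rewrite subrK; lra.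
Qed.
End FailureFunctional.


(** * Nets, nuclear representations and the local properties *)

Section NetLimsup.
Context {R : realType} {I : directed_set}.

Lemma net_limsup_le (a : I -> \bar R) (c : \bar R) :
  (forall e : R, 0 < e -> exists i, forall j, dir_le i j -> (a j <= c + e%:E)%E) ->
  (net_limsup a <= c)%E.
Proof.
move=> h; apply/lee_addgt0Pr => e /h[i ie].
apply: (@le_trans _ _ (ereal_sup [set a j | j in [set j | dir_le i j]])).
  by apply: ereal_inf_lbound; exists i.
by apply: ge_ereal_sup => _ [j ij <-]; exact: ie.
Qed.

Lemma net_limsup_lt (a : I -> \bar R) (c : \bar R) : (net_limsup a < c)%E ->
  exists i, forall j, dir_le i j -> (a j <= c)%E.
Proof.
move=> /ereal_inf_lt[_ [i _ <-] ic]; exists i => j ij.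
by apply: (le_trans _ (ltW ic)); apply: ereal_sup_ubound; exists j.
Qed.
End NetLimsup.

Lemma nat_dir_upper (i j : nat) : exists k, (i <= k /\ j <= k)%N.
Proof. by exists (maxn i j); rewrite leq_maxl leq_maxr. Qed.

Definition nat_dir : directed_set :=
  DirectedSet (dir_carrier := nat) (dir_le := fun i j => (i <= j)%N)
    (inhabits 0%N) leqnn (fun i j k => @leq_trans j i k) nat_dir_upper.

Section NuclearRepresentations.
Context {R : realType} {s : scalars}.
Local Notation K := (scalar_field R s).

Lemma rnorm_lim_le (Y : normedModType K) (T : Type) (F : set_system T)
    {FF : ProperFilter F} (u : T -> Y) (l : Y) (C : R) :
  u @ F --> l -> (\forall t \near F, rnorm (u t) <= C) -> rnorm l <= C.
Proof.
move=> ul uC; apply/ler_addgt0Pr => e e0.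
have ule : F [set t | rnorm (l - u t) < e].
  exact: ((cvg_rnormP (FF := fmap_filter u _) l).1 ul).
have [t [tC te]] := filter_ex (filterI uC ule).
by rewrite -(subrK (u t) l) (le_trans (rnormD _ _))// addrC lerD// ltW.
Qed.

Context {X Y : banachType R s}.
Implicit Types (T : {linear X -> Y}) (f : nat -> {linear X -> K^o}) (y : nat -> Y).

(** Replaces the extended-real series by its real partial sums. *)
Lemma nuclear_sum_leP f y (C : R) : (forall n, continuous (f n)) ->
  (nuclear_sum f y <= C%:E)%E <->
  forall m, \sum_(n < m) fine (opnorm (f n)) * rnorm (y n) <= C.
Proof.
move=> cf; have fE n : (opnorm (f n) * (rnorm (y n))%:E)%E =
    (fine (opnorm (f n)) * rnorm (y n))%:E by rewrite [in LHS]opnorm_fin.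
have pos n : (0 <= n)%N -> true ->
    (0 <= opnorm (f n) * (rnorm (y n))%:E)%E.
  by move=> _ _; rewrite mule_ge0 ?opnorm_ge0// lee_fin rnorm_ge0.
have sumE m : (\sum_(0 <= n < m) (opnorm (f n) * (rnorm (y n))%:E))%E =
    (\sum_(n < m) fine (opnorm (f n)) * rnorm (y n))%:E.
  by rewrite big_mkord -sumEFin; apply: eq_bigr => n _; exact: fE.
split => [SC m|PC].
  rewrite -lee_fin -sumE (le_trans _ SC)//; exact: nneseries_lim_ge pos.
apply: lime_le; first exact: is_cvg_nneseries pos.
by apply: nearW => m; rewrite sumE lee_fin.
Qed.

Lemma nuclear_norm_le T f y (C : R) : nuclear_representation T f y ->
  (forall m, \sum_(n < m) fine (opnorm (f n)) * rnorm (y n) <= C) ->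
  (nuclear_norm T <= C%:E)%E.
Proof.
move=> Tfy /(nuclear_sum_leP _ _ Tfy.1); apply: le_trans.
by apply: ereal_inf_lbound; exists f, y.
Qed.

Lemma nuclear_norm_lt T (C : R) : (nuclear_norm T < C%:E)%E ->
  exists f y, nuclear_representation T f y /\
    forall m, \sum_(n < m) fine (opnorm (f n)) * rnorm (y n) <= C.
Proof.
move=> /ereal_inf_lt[_ [f [y [Tfy ->]]] /ltW SC].
by exists f, y; split => //; apply/nuclear_sum_leP => //; exact: Tfy.1.
Qed.

Lemma nuclear_norm_ge0 T : (0 <= nuclear_norm T)%E.
Proof.
apply: le_ereal_inf_tmp => _ [f [y [_ ->]]]; apply: nneseries_ge0 => n _ _.
by rewrite mule_ge0 ?opnorm_ge0// lee_fin rnorm_ge0.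
Qed.

Lemma nuclear_norm_fin T : nuclear T -> nuclear_norm T = (fine (nuclear_norm T))%:E.
Proof.
move=> [f [y [Tfy Sy]]]; rewrite fineK// ge0_fin_numE ?nuclear_norm_ge0//.
by rewrite (le_lt_trans _ Sy)//; apply: ereal_inf_lbound; exists f, y.
Qed.

Lemma rnorm_term_le f y (l : seq nat) x : (forall n, continuous (f n)) ->
  rnorm (\sum_(n <- l) (f n x : K) *: y n) <=
  (\sum_(n <- l) fine (opnorm (f n)) * rnorm (y n)) * rnorm x.
Proof.
move=> cf; rewrite (le_trans (rnorm_sum _ _))// mulr_suml ler_sum// => n _.
rewrite rnormZ mulrAC ler_wpM2r ?rnorm_ge0//; exact: rnorm_le_fine_opnorm.
Qed.

Lemma partial_sum_tail T f y (C e : R) (m : nat) : nuclear_representation T f y ->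
  (forall k, \sum_(n < k) fine (opnorm (f n)) * rnorm (y n) <= C) ->
  C - e <= \sum_(n < m) fine (opnorm (f n)) * rnorm (y n) ->
  forall x, rnorm (T x - partial_sum f y m x) <= e * rnorm x.
Proof.
move=> [cf Tfy] SC Cm x.
apply: (@rnorm_lim_le _ nat \oo _
    (fun k => series (fun n => (f n x : K) *: y n) k - partial_sum f y m x)).
  by apply: cvgB; [exact: Tfy|exact: cvg_cst].
exists m => // k /= mk.
rewrite /series /= -(big_mkord predT (fun i => (f i x : K) *: y i)).
rewrite (big_cat_nat (leq0n m) mk) /= addrAC subrr add0r.
rewrite (le_trans (rnorm_term_le _ _ _ cf))// ler_wpM2r ?rnorm_ge0//.
have := SC k; rewrite -(big_mkord predT (fun n => fine (opnorm (f n)) * rnorm (y n))).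
move: Cm; rewrite -(big_mkord predT (fun n => fine (opnorm (f n)) * rnorm (y n))).
rewrite (big_cat_nat (leq0n m) mk) /=; lra.
Qed.

(** A truncated representation is completed by zero vectors. *)
Lemma nuclear_norm_partial_sum_le f y (C : R) m : (forall n, continuous (f n)) ->
  (forall k, \sum_(n < k) fine (opnorm (f n)) * rnorm (y n) <= C) ->
  (nuclear_norm (partial_sum f y m) <= C%:E)%E.
Proof.
move=> cf SC; pose z n := if (n < m)%N then y n else 0.
apply: (@nuclear_norm_le _ f z).
  split => // x; apply: cvg_near_cst; exists m => // k /= mk.
  rewrite /series /= (big_cat_nat (leq0n m) mk) /= big_mkord.
  rewrite [X in _ + X]big_nat_cond [X in _ + X]big1 ?addr0; last first.
    by move=> i; rewrite andbT => /andP[mi _]; rewrite /z ltnNge mi scaler0.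
  by rewrite /partial_sum /=; apply: eq_bigr => i _; rewrite /z ltn_ord.
move=> k; rewrite (le_trans _ (SC k))// ler_sum// => n _.
rewrite ler_wpM2l ?fine_opnorm_ge0// /z; case: ifP => // _.
by rewrite rnorm0 rnorm_ge0.
Qed.

Lemma sum_nearly_attained f y (C e : R) : (forall n, continuous (f n)) ->
  0 < e -> C%:E = nuclear_sum f y ->
  exists m, C - e <= \sum_(n < m) fine (opnorm (f n)) * rnorm (y n).
Proof.
move=> cf e0 CE; apply: contrapT => h.
suff : (nuclear_sum f y <= (C - e)%:E)%E.
  by rewrite -CE lee_fin; lra.
apply/nuclear_sum_leP => // m; rewrite leNgt; apply/negP => hm; apply: h.
by exists m; exact: ltW.
Qed.

End NuclearRepresentations.

Section LocalMAP.
Context {R : realType} {s : scalars} {X : banachType R s}.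

(** Convergence in operator norm implies pointwise convergence, so the errors
    [2^-k] provide a sequence that serves as the net. *)
Lemma local_MAP_of_approx (A : normed_class R s) :
  (forall (Y : banachType R s) (T : {linear X -> Y}) (e : R), in_class A T -> 0 < e ->
    exists U : {linear X -> Y}, [/\ finite_rank U,
      forall x, rnorm (T x - U x) <= e * rnorm x &
      (class_norm A U <= class_norm A T + e%:E)%E]) ->
  local_MAP A X.
Proof.
move=> h Y T AT.
have hk k : 0 < (2 : R)^-1 ^+ k by rewrite exprn_gt0// invr_gt0.
have [U UP] := choice (fun k : nat => h Y T _ AT (hk k)).
have le_hk (k j : nat) : (k <= j)%N -> (2 : R)^-1 ^+ j <= 2^-1 ^+ k.
  by move=> kj; rewrite ler_wiXn2l ?invr_ge0// invf_le1 ?ler1n.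
exists nat_dir, U; split => [k|x|]; first by have [] := UP k.
  apply/cvg_rnormP => e e0.
  have x1 : 0 < rnorm x + 1 by rewrite ltr_wpDl// rnorm_ge0.
  have [k ke] := half_pow_lt (divr_gt0 e0 x1).
  exists k => // j kj /=; have [_ + _] := UP j => /(_ x) /le_lt_trans; apply.
  rewrite (le_lt_trans (ler_wpM2r (rnorm_ge0 x) (le_hk _ _ kj)))//.
  move: ke; rewrite ltr_pdivlMr//; apply: le_lt_trans.
  by rewrite ler_wpM2l ?(ltW (hk _))// lerDl.
rewrite mul1e; apply: net_limsup_le => e /half_pow_lt[k ke]; exists k => j kj.
have [_ _ Uj] := UP j; rewrite (le_trans Uj)// leeD2l// lee_fin.
exact: le_trans (le_hk _ _ kj) (ltW ke).
Qed.

Lemma local_MAP_approximable : local_MAP (approximable_ideal R s) X.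
Proof.
apply: local_MAP_of_approx => Y T e [F [fF F0]] e0.
have e0' : (0 < e%:E)%E by rewrite lte_fin.
have [n _ /(_ n (leqnn n)) /= /ltW nTe] :=
  F0 [set u | (u < e%:E)%E] (open_ereal_lt_ereal e0').
have TFe := rnorm_le_opnorm nTe.
exists (F n); split => //=.
apply: ge_ereal_sup => _ [x /= x1 <-].
apply: (@le_trans _ _ ((rnorm (T x))%:E + e%:E)%E); last first.
  by rewrite leeD2r//; apply: ereal_sup_ubound; exists x.
rewrite -EFinD lee_fin -(subKr (T x) (F n x)) (le_trans (rnormB _ _))// lerD2l.
by rewrite (le_trans (TFe x))// ler_piMr ?(ltW e0).
Qed.

(** Partial sums of a representation within [e] of the optimum are used, long enough for
    the tail to be at most [e] as well. *)
Lemma local_MAP_nuclear : local_MAP (nuclear_ideal R s) X.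
Proof.
apply: local_MAP_of_approx => Y T e nT e0 /=.
have NT := nuclear_norm_fin nT; set N := fine _ in NT.
have /ereal_inf_lt[_ [f [y [Tfy ->]]] Se] : (nuclear_norm T < (N + e)%:E)%E.
  by rewrite NT lte_fin ltrDl.
have Sfin : nuclear_sum f y = (fine (nuclear_sum f y))%:E.
  rewrite fineK// ge0_fin_numE; first exact: lt_trans Se (ltry _).
  apply: (@le_trans _ _ (nuclear_norm T)); first exact: nuclear_norm_ge0.
  by apply: ereal_inf_lbound; exists f, y.
set C := fine _ in Sfin.
have SC : forall m, \sum_(n < m) fine (opnorm (f n)) * rnorm (y n) <= C.
  by apply/(nuclear_sum_leP _ _ Tfy.1); rewrite Sfin.
have [m Cm] := sum_nearly_attained Tfy.1 e0 (esym Sfin).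
exists (partial_sum f y m); split.
- exact: finite_rank_partial_sum Tfy.1.
- exact: partial_sum_tail Tfy SC Cm.
- rewrite (le_trans (nuclear_norm_partial_sum_le m Tfy.1 SC))//.
  by rewrite NT -EFinD -Sfin ltW.
Qed.

End LocalMAP.


(** * Diagonal operators and the trace argument *)

Section DiagonalOperator.
Context {R : realType} {s : scalars} {X : banachType R s} {B : nat -> seq nat}.
Hypothesis uB : forall k, uniq (k :: B k).
Local Notation K := (scalar_field R s).
Variables (w : nat -> {linear X -> K^o}) (e : X).
Hypothesis wB : forall z : X, (fun n => (w n z : K) *: e) \in block_bounded X B.

Lemma diagonal_is_linear : linear (fun z => BlockSpace (wB z) : block_banach X B).
Proof.
move=> a x y; apply: val_inj; apply/funext => i.
change ((w i (a *: x + y) : K) *: e = a *: ((w i x : K) *: e) + (w i y : K) *: e).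
by rewrite linearP scalerDl scalerA.
Qed.

Definition diagonal : {linear X -> block_banach X B} := linear_of diagonal_is_linear.

(** Partial sums of [sum_n w_n (.) (e at position n)] truncate the diagonal
    operator, which yields both its approximability and its nuclear
    representation. *)
Lemma diagonal_partial_sumE z N i :
  block_seq (diagonal z - partial_sum w (fun n => single uB n e) N z) i =
  if (i < N)%N then 0 else (w i z : K) *: e.
Proof.
have -> : partial_sum w (fun n => single uB n e) N z =
    \sum_(n < N) single uB n ((w n z : K) *: e).
  apply: eq_bigr => n _.
  by rewrite -(linearZ_LR (linear_of (single_is_linear uB n))).
rewrite block_spaceB.
change ((w i z : K) *: e - block_seq (\sum_(n < N) single uB n ((w n z : K) *: e)) i =
  if (i < N)%N then 0 else (w i z : K) *: e).
rewrite (sum_singleE uB (fun n => (w n z : K) *: e)).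
by case: ifP => _; rewrite ?subrr ?subr0.
Qed.
End DiagonalOperator.

Section TraceArgument.
Context {R : realType} {s : scalars} {X : banachType R s} {B : nat -> seq nat}.
Local Notation K := (scalar_field R s).
Variables (w : nat -> {linear X -> K^o}) (v : nat -> X) (e : X) (d : R).
Hypothesis cw : forall n, continuous (w n).
Hypothesis wB : forall z : X, (fun n => (w n z : K) *: e) \in block_bounded X B.
Hypothesis e_neq0 : 0 < rnorm e.
Hypothesis d_gt0 : 0 < d.
Hypothesis trace_finite_rank : forall (S : {linear X -> X}) (eps : R),
  finite_rank S -> 0 < eps ->
  \forall N \near \oo, rnorm (\sum_(n < N) w n (S (v n)) : K^o) <= eps.
Hypothesis trace_id : \forall N \near \oo, d <= rnorm (\sum_(n < N) w n (v n) : K^o).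
Variable A : normed_class R s.
Hypothesis tails : forall C eps : R, 0 < eps ->
  exists M, forall U : {linear X -> block_banach X B},
    (class_norm A U <= C%:E)%E -> forall N, (M <= N)%N ->
    rnorm (\sum_(M <= n < N) block_seq (U (v n)) n) <= eps.

Let T := diagonal wB.

Let trace_sum (S : X -> X) (N : nat) : X := \sum_(n < N) block_seq (T (S (v n))) n.

Let trace_sumE S N : trace_sum S N = (\sum_(n < N) w n (S (v n)) : K) *: e.
Proof. by rewrite scaler_suml; exact: eq_bigr. Qed.

Let rnorm_trace_sum S N :
  rnorm (trace_sum S N) = rnorm (\sum_(n < N) w n (S (v n)) : K^o) * rnorm e.
Proof. by rewrite trace_sumE rnormZ. Qed.

(** The pairing [U |-> sum_n (U v_n)_n] is continuous for pointwise
    convergence on norm-bounded sets of the class, by the uniform smallness of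
    the tails. It vanishes at [T S] for [S] of finite rank, and not at [T]. *)
Lemma not_weak_lambda_BAP (lambda : R) : in_class A T ->
  class_norm A T = (fine (class_norm A T))%:E -> ~ weak_lambda_BAP A lambda X.
Proof.
move=> AT ATfin wBAP.
have [I [S [fS S1 limS]]] := wBAP _ T AT.
pose a := fine (class_norm A T).
(* A bound valid both for T and for all late operators T \o S j. *)
pose C := Num.max (lambda * a + 1) a.
have [i0 hi0] : exists i, forall j, dir_le i j ->
    (class_norm A (T \o S j)%FUN <= C%:E)%E.
  apply: net_limsup_lt; apply: (le_lt_trans limS).
  rewrite ATfin -EFinM lte_fin -/a; apply: (@lt_le_trans _ _ (lambda * a + 1)).
    by rewrite ltrDl.
  by rewrite le_max lexx.
(* The trace at the identity has norm at least 8 * eta, while it differs from the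
   trace at S j, itself at most eta, by three terms of norm at most eta. *)
pose eta := d * rnorm e / 8.
have eta0 : 0 < eta by rewrite !divr_gt0 ?mulr_gt0.
(* M is fixed before j: the tails beyond M are small for all operators at once. *)
have [M hM] := tails C eta0.
have [j [ij Sj]] : exists j, dir_le i0 j /\
    rnorm (trace_sum (S j) M - trace_sum id M) <= eta.
  have cvgS : trace_sum (S j) M @[j --> net_filter I] --> trace_sum id M.
    apply: cvg_big => [|n _]; first exact: add_continuous.
    change ((w n (S j (v n)) : K) *: e @[j --> net_filter I] --> (w n (v n) : K) *: e).
    apply: cvgZl.
    by apply: (cvg_comp (fun i => S i (v n)) (w n) (S1 (v n))); exact: cw.
  have := (cvg_rnormP (FF := fmap_filter (fun j => trace_sum (S j) M) _) _).1 cvgS _ eta0.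
  move=> [i1 _ hi1]; have [j [i0j i1j]] := dir_upper i0 i1; exists j; split => //.
  by rewrite rnormBC ltW//; exact: (hi1 j i1j).
have [N1 _ hN1] := trace_finite_rank (fS j) (divr_gt0 d_gt0 (ltr0n _ 8)).
have [N2 _ hN2] := trace_id.
pose N := maxn M (maxn N1 N2).
have MN : (M <= N)%N by exact: leq_maxl.
have trN S' : trace_sum S' N = trace_sum S' M +
    \sum_(M <= n < N) block_seq (T (S' (v n))) n.
  rewrite /trace_sum -!(big_mkord predT (fun n => block_seq (T (S' (v n))) n)).
  by rewrite (big_cat_nat (leq0n M) MN).
have tr1 : rnorm (trace_sum (S j) N) <= eta.
  rewrite rnorm_trace_sum /eta mulrAC ler_wpM2r ?rnorm_ge0//.
  by apply: hN1; rewrite /= /N (leq_trans _ (leq_maxr _ _))// leq_maxl.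
have tr2 : 8 * eta <= rnorm (trace_sum id N).
  rewrite rnorm_trace_sum /eta mulrC divfK// ler_wpM2r ?rnorm_ge0//.
  by apply: hN2; rewrite /= /N (leq_trans _ (leq_maxr _ _))// leq_maxr.
have tail1 : rnorm (\sum_(M <= n < N) block_seq (T (S j (v n))) n) <= eta.
  exact: (hM _ (hi0 j ij) N MN).
have tail2 : rnorm (\sum_(M <= n < N) block_seq (T (v n)) n) <= eta.
  by apply: (hM T _ N MN); rewrite ATfin lee_fin le_max lexx orbT.
have := trN id; have := trN (S j); rewrite /=.
move: tail1 tail2; set t1 := \sum_(_ <= _ < _) _; set t2 := \sum_(_ <= _ < _) _ => h1 h2 e1 e2.
have : trace_sum id N = trace_sum (S j) N - (trace_sum (S j) M - trace_sum id M) - t1 + t2.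
  by rewrite e1 e2; congr (_ + _); rewrite opprB addrAC addrK subrKC.
move=> tE; move: tr2; rewrite tE => tr2.
have := rnormD (trace_sum (S j) N - (trace_sum (S j) M - trace_sum id M) - t1) t2.
have := rnormB (trace_sum (S j) N - (trace_sum (S j) M - trace_sum id M)) t1.
have := rnormB (trace_sum (S j) N) (trace_sum (S j) M - trace_sum id M).
lra.
Qed.
End TraceArgument.


(** * Nuclear operators *)

Lemma small_tail {R : realType} (c : nat -> R) (C e : R) : (forall n, 0 <= c n) ->
  (forall N, \sum_(n < N) c n <= C) -> 0 < e ->
  exists M, forall N, (M <= N)%N -> \sum_(M <= n < N) c n <= e.
Proof.
move=> c0 cC e0; pose P := range (fun N => \sum_(n < N) c n).
have Psup : has_sup P.
  by split; [exists (\sum_(n < 0) c n), 0%N|exists C => _ [N _ <-]; exact: cC].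
have [_ [M _ <-] hM] := sup_adherent e0 Psup.
exists M => N MN; have : \sum_(n < N) c n <= sup P.
  by apply: (sup_upper_bound Psup); exists N.
rewrite -(big_mkord predT c) (big_cat_nat (leq0n M) MN) /= big_mkord.
by move: hM; lra.
Qed.

Section Failure.
Context {R : realType} {s : scalars} {X : banachType R s}.
Local Notation K := (scalar_field R s).

Lemma exists_nonzero (w : nat -> {linear X -> K^o}) (v : nat -> X) (d : R) :
  0 < d -> (\forall N \near \oo, d <= rnorm (\sum_(n < N) w n (v n) : K^o)) ->
  exists e : X, 0 < rnorm e.
Proof.
move=> d0 [N _ /(_ N (leqnn N)) /= dN]; apply: contrapT => h.
move: dN; rewrite big1 ?rnorm0 ?leNgt ?d0// => n _.
suff -> : v n = 0 by rewrite linear0.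
apply: rnorm0_eq0; apply/le_anti; rewrite rnorm_ge0 andbT leNgt.
by apply/negP => v0; apply: h; exists (v n).
Qed.

Lemma uniq_iota_cons (k : nat) : uniq (k :: iota 0 k).
Proof. by rewrite cons_uniq mem_iota iota_uniq ltnn. Qed.

Lemma block_sum_iota (z : nat -> X) k :
  block_sum (iota 0) z k = \sum_(i < k.+1) rnorm (z i).
Proof.
rewrite /block_sum big_cons addrC big_ord_recr /=; congr (_ + _).
by rewrite -(big_mkord predT (fun i => rnorm (z i))) /index_iota subn0.
Qed.

(** The target is [l_1(X)], and the diagonal operator with coefficients [a] is
    nuclear. In a nuclear representation [sum_k f_k (.) y_k] the pairing
    [sum_n f_k (x_n) (y_k)_n] is controlled by [sup |x_n|] times the
    [l_1]-norm of [y_k]. *)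
Lemma not_weak_BAP_nuclear : ~ approximation_property X ->
  ~ weak_BAP (nuclear_ideal R s) X.
Proof.
move=> nAP [lambda _]; have [a [x [d [ca x0 d0 a1 [trS trI]]]]] :=
  approximation_property_failure nAP.
have [e e0] := exists_nonzero d0 trI.
have aB z : (fun n => (a n z : K) *: e) \in block_bounded X (iota 0).
  apply/asboolP; exists (rnorm z * rnorm e) => k; rewrite block_sum_iota.
  under eq_bigr do rewrite rnormZ.
  rewrite -mulr_suml ler_wpM2r ?rnorm_ge0// -[leRHS]mul1r.
  rewrite (le_trans _ (ler_wpM2r (rnorm_ge0 z) (a1 k.+1)))// mulr_suml ler_sum// => i _.
  exact: rnorm_le_fine_opnorm.
pose T := diagonal aB.
pose y n := single uniq_iota_cons n e.
have sum_le m : \sum_(n < m) fine (opnorm (a n)) * rnorm (y n) <= rnorm e.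
  rewrite -[leRHS]mul1r (le_trans _ (ler_wpM2r (rnorm_ge0 e) (a1 m)))//.
  rewrite mulr_suml ler_sum// => n _.
  by rewrite ler_wpM2l ?fine_opnorm_ge0// rnorm_single_le.
have Trep : nuclear_representation T a y.
  split => // z; apply/cvg_rnormP => eps eps0.
  have c0 n : 0 <= rnorm ((a n z : K) *: e) by exact: rnorm_ge0.
  have /asboolP[C hC] := aB z.
  have cC N : \sum_(n < N) rnorm ((a n z : K) *: e) <= C.
    case: N => [|N]; last by rewrite -(block_sum_iota (fun n => (a n z : K) *: e)).
    by rewrite big_ord0 (le_trans (block_sum_ge0 (iota 0) (fun n => (a n z : K) *: e) 0)).
  have [M hM] := small_tail c0 cC (divr_gt0 eps0 (ltr0n _ 2)).
  exists M => // N /= MN; rewrite /series /= big_mkord.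
  apply: (@le_lt_trans _ _ (eps / 2)); last by rewrite ltr_pdivrMr// ltr_pMr// ltr1n.
  apply: (@rnorm_block_le _ _ X (iota 0) (T z - partial_sum a y N z)) => k.
  rewrite block_sum_iota.
  under eq_bigr do rewrite (diagonal_partial_sumE uniq_iota_cons).
  have [kM|Mk] := ltnP k M.
    rewrite big1 ?divr_ge0 ?(ltW eps0)// => i _.
    rewrite (_ : (i < N)%N) ?rnorm0//.
    by rewrite (leq_trans _ MN)// (leq_trans _ kM).
  rewrite (le_trans _ (hM k.+1 (leqW Mk)))//.
  rewrite -(big_mkord predT (fun i => rnorm (if (i < N)%N then 0 else (a i z : K) *: e))).
  rewrite (big_cat_nat (leq0n M) (leqW Mk)) /= big_nat_cond big1 ?add0r; last first.
    by move=> i; rewrite andbT => /andP[_ iM]; rewrite (leq_trans iM MN) rnorm0.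
  by apply: ler_sum => i _; case: ifP => // _; rewrite rnorm0.
have nT : nuclear T.
  exists a, y; split => //; apply: (@le_lt_trans _ _ (rnorm e)%:E); last exact: ltry.
  exact/nuclear_sum_leP.
apply: (not_weak_lambda_BAP (A := nuclear_ideal R s) ca (wB := aB) e0 d0 trS trI) => //.
  move=> C eps eps0.
  have C0 : 0 < `|C| + 1 by rewrite ltr_wpDl.
  have [M _ hM] := (cvg_rnormP 0).1 x0 _ (divr_gt0 eps0 C0).
  exists M => U /= UC N MN.
  have [f [u [[cf Ufu] fuC]]] : exists f u, nuclear_representation U f u /\
      forall m, \sum_(n < m) fine (opnorm (f n)) * rnorm (u n) <= `|C| + 1.
    apply: nuclear_norm_lt; apply: (le_lt_trans UC).
    by rewrite lte_fin (le_lt_trans (ler_norm C))// ltrDl.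
  (* The coordinates of U (x n) are limits of those of the partial sums, on which
     the estimate is made uniformly in the length m. *)
  pose coord n (z : block_banach X (iota 0)) := block_seq z n.
  pose q n (m : nat) : block_banach X (iota 0) := series (fun k => (f k (x n) : K) *: u k) m.
  have coord_cvg n : coord n (q n m) @[m --> \oo] --> coord n (U (x n)).
    apply/(cvg_rnormP (FF := fmap_filter (fun m => coord n (q n m)) _)) => t t0.
    have ht : \forall m \near \oo, rnorm (U (x n) - q n m) < t.
      exact: ((cvg_rnormP (FF := fmap_filter (q n) _) (U (x n))).1 (Ufu (x n)) t t0).
    have : \forall m \near \oo, rnorm (coord n (U (x n)) - coord n (q n m)) < t.
      apply: filterS ht => m; apply: le_lt_trans.
      exact: (@rnorm_coord_le _ _ X (iota 0) (U (x n) - q n m) n).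
    by [].
  apply: (@rnorm_lim_le _ _ X nat \oo _ (fun m => \sum_(M <= n < N) coord n (q n m))).
    by apply: cvg_big => // ; exact: add_continuous.
  apply: nearW => m.
  have coordE n : coord n (q n m) =
      \sum_(k < m) (f k (x n) : K) *: coord n (u k).
    rewrite /q /series /= big_mkord.
    have cL : linear (coord n) by move=> b z z'.
    rewrite -[coord n _]/(linear_of cL _) raddf_sum; apply: eq_bigr => k _.
    exact: (linearZ_LR (linear_of cL)).
  under eq_bigr do rewrite coordE.
  rewrite (le_trans (rnorm_sum _ _))//.
  apply: (@le_trans _ _ (\sum_(M <= n < N) \sum_(k < m)
      eps / (`|C| + 1) * (fine (opnorm (f k)) * rnorm (coord n (u k))))).
    rewrite big_nat_cond [leRHS]big_nat_cond.
    apply: ler_sum => n; rewrite andbT => /andP[Mn _].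
    rewrite (le_trans (rnorm_sum _ _))// ler_sum// => k _.
    rewrite rnormZ mulrA ler_wpM2r ?rnorm_ge0// mulrC.
    rewrite (le_trans (rnorm_le_fine_opnorm (cf k) _))// ler_wpM2l ?fine_opnorm_ge0//.
    by have := hM n Mn; rewrite /= sub0r rnormN => /ltW.
  rewrite exchange_big /=.
  under eq_bigr do rewrite -mulr_sumr -mulr_sumr.
  rewrite -mulr_sumr mulrAC ler_pdivrMr// ler_wpM2l ?(ltW eps0)//.
  rewrite (le_trans _ (fuC m))// ler_sum// => k _.
  rewrite ler_wpM2l ?fine_opnorm_ge0//.
  rewrite (le_trans _ (block_sum_le_rnorm (u k) N))// block_sum_iota.
  rewrite -(big_mkord predT (fun i => rnorm (block_seq (u k) i))).
  rewrite (big_cat_nat (leq0n M) (leqW MN)) /= big_nat_recr//=.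
  by rewrite addrCA lerDl addr_ge0 ?rnorm_ge0// sumr_ge0// => i _; exact: rnorm_ge0.
exact: nuclear_norm_fin.
Qed.
End Failure.


(** * Approximable operators *)

Lemma cvge0_of_small {R : realType} (u : nat -> \bar R) :
  (forall n, (0 <= u n)%E) ->
  (forall e : R, 0 < e -> \forall n \near \oo, (u n <= e%:E)%E) ->
  u @ \oo --> 0%E.
Proof.
move=> u0 ue; apply/fine_cvgP; split.
  apply: filterS (ue 1 ltr01) => n un.
  by rewrite ge0_fin_numE// (le_lt_trans un) ?ltry.
apply/cvgrPdist_le => e /ue; apply: filterS => n un.
rewrite sub0r normrN /= ger0_norm ?fine_ge0// -lee_fin fineK//.
by rewrite ge0_fin_numE// (le_lt_trans un) ?ltry.
Qed.

Section FailureApproximable.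
Context {R : realType} {s : scalars} {X : banachType R s}.
Local Notation K := (scalar_field R s).

Lemma sum_half_pow_le N : \sum_(n < N) (2 : R)^-1 ^+ n <= 2.
Proof.
have -> : \sum_(n < N) (2 : R)^-1 ^+ n = 2 - 2 * 2^-1 ^+ N.
  elim: N => [|N IH]; first by rewrite big_ord0 expr0; lra.
  by rewrite big_ord_recr /= IH exprS; lra.
by rewrite gerBl mulr_ge0// exprn_ge0// invr_ge0.
Qed.

(** Moving weight from the vectors to the functionals, without changing the
    products [a_n(S x_n)]: the functionals become null and the vectors
    summable. *)
Lemma rescale (a : nat -> {linear X -> K^o}) (x : nat -> X) :
  (forall n, continuous (a n)) -> x @ \oo --> 0 ->
  (forall N, \sum_(n < N) fine (opnorm (a n)) <= 1) ->
  exists (w : nat -> {linear X -> K^o}) (v : nat -> X) (th : nat -> R) (C : R),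
  [/\ forall (S : {linear X -> X}) n, (w n (S (v n)) : K) = a n (S (x n)),
      forall n, 0 <= th n, forall e, 0 < e -> \forall n \near \oo, th n <= e,
      forall n z, rnorm (w n z) <= th n * rnorm z &
      forall N, \sum_(n < N) rnorm (v n) <= C].
Proof.
move=> ca x0 a1; pose h n : R := 2^-1 ^+ n.
have h0 n : 0 < h n by rewrite exprn_gt0// invr_gt0.
(* The terms h n keep al n and th n positive. *)
pose al n := fine (opnorm (a n)) + h n.
have al0 n : 0 < al n by rewrite ltr_wpDl ?fine_opnorm_ge0.
pose th n := Num.sqrt (rnorm (x n) + h n).
have th0 n : 0 < th n by rewrite sqrtr_gt0 ltr_wpDl ?rnorm_ge0.
have thE n : th n ^+ 2 = rnorm (x n) + h n.
  by rewrite sqr_sqrtr// addr_ge0 ?rnorm_ge0// ltW.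
have th_small e : 0 < e -> \forall n \near \oo, th n <= e.
  move=> e0; have e2 : 0 < e ^+ 2 / 2 by rewrite divr_gt0// exprn_gt0.
  have [k ke] := half_pow_lt e2.
  have [N _ hN] := (cvg_rnormP 0).1 x0 _ e2.
  exists (maxn N k) => // n /=; rewrite geq_max => /andP[Nn kn].
  rewrite -(ler_pXn2r (ltn0Sn 1)) ?nnegrE ?(ltW (th0 n)) ?(ltW e0)//.
  rewrite thE [leRHS]splitr lerD//; first by have := hN n Nn; rewrite /= sub0r rnormN => /ltW.
  by rewrite (le_trans _ (ltW ke))// ler_wiXn2l ?invr_ge0// invf_le1 ?ler1n.
have [D hD] : exists D, forall n, th n <= D.
  by apply: eventually_le1_bounded (th_small 1 ltr01) => n; exact: ltW.
(* The functionals get norm at most th n and the vectors norm at most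
   al n / th n * th n ^+ 2 = al n * th n, which is summable. *)
pose c n := th n / al n.
have c0 n : 0 < c n by rewrite divr_gt0.
exists (fun n => (of_real (c n) \*: a n : {linear X -> K^o})).
exists (fun n => of_real (c n)^-1 *: x n), th, (D * 3); split => //.
- move=> S n; rewrite linearZ_LR /=.
  change (of_real (c n) * a n (of_real (c n)^-1 *: S (x n)) = a n (S (x n))).
  have -> : a n (of_real (c n)^-1 *: S (x n)) = of_real (c n)^-1 * a n (S (x n)) :> K.
    exact: (linearZ_LR (a n)).
  by rewrite mulrA -of_realM divff ?gt_eqF// of_real1 mul1r.
- by move=> n; exact: ltW.
- move=> n z /=; rewrite (@rnormZr _ _ K^o) gtr0_norm//.
  rewrite (le_trans (ler_wpM2l (ltW (c0 n)) (rnorm_le_fine_opnorm (ca n) z)))//.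
  rewrite mulrA ler_wpM2r ?rnorm_ge0// /c mulrAC ler_pdivrMr// ler_wpM2l ?(ltW (th0 n))//.
  by rewrite /al lerDl ltW.
- move=> N; apply: (@le_trans _ _ (D * \sum_(n < N) al n)).
    rewrite mulr_sumr ler_sum// => n _; rewrite rnormZr gtr0_norm ?invr_gt0//.
    rewrite /c invf_div -mulrA mulrC ler_wpM2r ?(ltW (al0 n))//.
    by rewrite (le_trans _ (hD n))// ler_pdivrMl// -expr2 thE lerDl ltW.
  have D0 : 0 <= D by exact: le_trans (ltW (th0 0%N)) (hD 0%N).
  rewrite ler_wpM2l// big_split /= (_ : 3 = 1 + 2); last by lra.
  by rewrite lerD//; [exact: a1|exact: sum_half_pow_le].
Qed.

(** The target is [l_oo(X)]: the diagonal operator with null coefficients is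
    approximable, and the pairing is controlled by the operator norm because
    the vectors are summable. *)
Lemma not_weak_BAP_approximable : ~ approximation_property X ->
  ~ weak_BAP (approximable_ideal R s) X.
Proof.
move=> nAP [lambda _]; have [a [x [d [ca x0 d0 a1 [trS trI]]]]] :=
  approximation_property_failure nAP.
have [e e0] := exists_nonzero d0 trI.
have [w [v [th [C [wv th0 th_small w_le vC]]]]] := rescale ca x0 a1.
have [D hD] := eventually_le1_bounded th0 (th_small 1 ltr01).
have cw n : continuous (w n).
  by apply/linear_continuousP; exists (th n).
have wB z : (fun n => (w n z : K) *: e) \in block_bounded X (fun=> [::]).
  apply/asboolP; exists (D * rnorm z * rnorm e) => k; rewrite /block_sum big_seq1.
  rewrite rnormZ ler_wpM2r ?rnorm_ge0// (le_trans (w_le _ _))//.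
  by rewrite ler_wpM2r ?rnorm_ge0.
pose T := diagonal wB.
have Tle z : rnorm (T z) <= D * rnorm e * rnorm z.
  apply: rnorm_bounded_le => n; rewrite rnormZ mulrAC ler_wpM2r ?rnorm_ge0//.
  by rewrite (le_trans (w_le _ _))// ler_wpM2r ?rnorm_ge0.
have D0 : 0 <= D by exact: le_trans (th0 0%N) (hD 0%N).
have cT : continuous T.
  by apply/linear_continuousP; exists (D * rnorm e); split; rewrite ?mulr_ge0 ?rnorm_ge0.
have aT : approximable T.
  exists (partial_sum w (fun n => single uniq_singleton n e)); split.
    by move=> n; exact: finite_rank_partial_sum.
  have small eps : 0 < eps -> \forall n \near \oo, (opnorm (T \- partial_sum w
      (fun n => single uniq_singleton n e) n)%R <= eps%:E)%E.
    move=> eps0; have [N _ hN] := th_small _ (divr_gt0 eps0 e0).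
    exists N => // n /= Nn; apply: opnorm_le; first exact: ltW.
    move=> z; apply: (@rnorm_bounded_le _ _ _ (T z - partial_sum w _ n z)) => i.
    rewrite diagonal_partial_sumE; case: ltnP => [_|ni].
      by rewrite rnorm0 mulr_ge0 ?rnorm_ge0// ltW.
    rewrite rnormZ -ler_pdivlMr// mulrAC (le_trans (w_le _ _))//.
    by rewrite ler_wpM2r ?rnorm_ge0// hN//= (leq_trans Nn).
  by apply: cvge0_of_small => // n; exact: opnorm_ge0.
have trE N (S : {linear X -> X}) :
    \sum_(n < N) (w n (S (v n)) : K^o) = \sum_(n < N) (a n (S (x n)) : K^o).
  by apply: eq_bigr => n _; exact: wv.
apply: (not_weak_lambda_BAP (A := approximable_ideal R s) cw (wB := wB) (v := v) e0 d0 _ _) => //.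
- move=> S eps fS eps0; apply: filterS (trS S eps fS eps0) => N.
  by rewrite trE.
- apply: filterS trI => N; by have := trE N idfun => /= ->.
- move=> C' eps eps0 /=.
  have C0 : 0 < `|C'| + 1 by rewrite ltr_wpDl.
  have [M hM] := small_tail (fun n => rnorm_ge0 (v n)) vC (divr_gt0 eps0 C0).
  exists M => U UC N MN.
  rewrite (le_trans (rnorm_sum _ _))//.
  apply: (@le_trans _ _ ((`|C'| + 1) * \sum_(M <= n < N) rnorm (v n))).
    rewrite mulr_sumr ler_sum// => n _.
    rewrite (le_trans (rnorm_coord_le _ _))//.
    rewrite (le_trans (rnorm_le_opnorm UC _))// ler_wpM2r ?rnorm_ge0//.
    by rewrite (le_trans (ler_norm C'))// lerDl.
  by rewrite mulrC -ler_pdivlMr// hM.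
- exact: opnorm_fin.
Qed.
End FailureApproximable.


(** * The proposition *)

Theorem proposition2p2 (R : realType) (s : scalars) (X : banachType R s) :
  local_MAP (approximable_ideal R s) X /\
  local_MAP (nuclear_ideal R s) X /\
  (~ approximation_property X ->
   ~ weak_BAP (approximable_ideal R s) X /\
   ~ weak_BAP (nuclear_ideal R s) X).
Proof.
split; first exact: local_MAP_approximable.
split; first exact: local_MAP_nuclear.
move=> nAP; split.
  exact: not_weak_BAP_approximable.
exact: not_weak_BAP_nuclear.
Qed.
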